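(* Let $S^d$ be the unit sphere of dimension $d$, let $\mu$ be a probability measure on $S^d$ that is absolutely continuous with respect to the Riemannian volume measure, with density $f$, and let $F(x)=\int_{S^d}\frac12 \mathbf{d}^2(y,x)\,d\mu(y)$ be its Fréchet function. Fix a point $p\in S^d$ and an integer $j\in\{1,2,3,4\}$, and let $\mathcal{C}_p$ be the cut locus of $p$ (the antipode of $p$). Suppose there exists $\epsilon>0$ such that, on the ball $B_\epsilon(\mathcal{C}_p)$ of radius $\epsilon$ centered at $\mathcal{C}_p$, (i) $f$ is bounded on $B_\epsilon(\mathcal{C}_p)$, in case $d\ge j$; or (ii) $f$ vanishes on $B_\epsilon(\mathcal{C}_p)$, in case $d<j$. Then $F$ is differentiable of order $j$ in an open neighborhood of $p$.
   Context: $S^d$ carries its standard round metric and $\mathbf{d}$ is the great-circle geodesic distance. The density $f$ is taken with respect to the volume measure of $S^d$ (the paper calls it the distribution function of $\mu$). *)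

(* Defs.v *)
From HB Require Import structures.
From mathcomp Require Import all_boot all_order all_algebra.
From mathcomp Require Import all_classical all_reals all_analysis.
From mathcomp Require Import measurable_realfun.
From mathcomp Require Import ring lra.

Set Implicit Arguments.
Unset Strict Implicit.
Unset Printing Implicit Defensive.

Import Order.TTheory GRing.Theory Num.Theory.
Import numFieldNormedType.Exports.

Local Open Scope classical_set_scope.
Local Open Scope ring_scope.

Section lebesgue_step.
Context {R : realType} (n : nat).
Variable m : {sigma_finite_measure set (n.-tuple R) -> \bar R}.

Let T : measurableType _ := measurableTypeR R.

Definition tuple_cons (p : T * n.-tuple R) : n.+1.-tuple R :=
  [the n.+1.-tuple R of p.1 :: p.2].

Lemma measurable_tuple_cons : measurable_fun [set: T * n.-tuple R] tuple_cons.
Proof. exact: (@measurable_cons _ _ (T * n.-tuple R)%type R fst n snd). Qed.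

Definition lebesgue_step : set (n.+1.-tuple R) -> \bar R :=
  pushforward (lebesgue_measure \x m)%E tuple_cons.

Let lebesgue_step0 : lebesgue_step set0 = 0%E.
Proof. by rewrite /lebesgue_step /pushforward preimage_set0 measure0. Qed.

Let lebesgue_step_ge0 A : (0 <= lebesgue_step A)%E.
Proof. exact: (@measure_ge0 _ _ _ (lebesgue_measure \x m)%E). Qed.

Let lebesgue_step_sigma_additive : semi_sigma_additive lebesgue_step.
Proof.
apply: measure_semi_sigma_additive; exact: measurable_tuple_cons.
Qed.

HB.instance Definition _ := isMeasure.Build _ _ _ lebesgue_step
  lebesgue_step0 lebesgue_step_ge0 lebesgue_step_sigma_additive.

Let lebesgue_step_sigma_finite : sigma_finite setT lebesgue_step.
Proof.
pose uncons (t : n.+1.-tuple R) : T * n.-tuple R :=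
  (thead t, [tuple of behead t]).
have consK : cancel tuple_cons uncons.
  by case=> x t; rewrite /uncons theadE; congr pair; exact/val_inj.
have unconsK : cancel uncons tuple_cons.
  by move=> t; apply/val_inj; rewrite /= [in RHS](tuple_eta t).
have muncons : measurable_fun [set: n.+1.-tuple R] uncons.
  apply/measurable_fun_pairP; split.
    exact: measurable_tnth.
  exact: measurable_behead.
have /sigma_finiteP[F [TF ndF Foo]] :=
  sigma_finiteT (@lebesgue_measure R).
have /sigma_finiteP[G [TG ndG Goo]] := sigma_finiteT m.
exists (fun k => uncons @^-1` (F k `*` G k)).
  apply/esym; rewrite -subTset => t _.
  have [i _ Fi] : (\bigcup_i F i) (uncons t).1 by rewrite -TF.
  have [j _ Gj] : (\bigcup_i G i) (uncons t).2 by rewrite -TG.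
  exists (maxn i j) => //; split.
  - by move: Fi; exact/subsetPset/ndF/leq_maxl.
  - by move: Gj; exact/subsetPset/ndG/leq_maxr.
move=> k; have [mF Fk] := Foo k; have [mG Gk] := Goo k; split.
  by rewrite -[X in measurable X]setTI; apply: muncons => //; exact: measurableX.
rewrite /lebesgue_step /pushforward -comp_preimage (_ : uncons \o _ = id).
  by rewrite preimage_id product_measure1E// lte_mul_pinfty// ge0_fin_numE.
by apply/funext => p /=; rewrite consK.
Qed.

HB.instance Definition _ := Measure_isSigmaFinite.Build _ _ _ lebesgue_step
  lebesgue_step_sigma_finite.

End lebesgue_step.

(* Lebesgue measure on R^n, as an iterated product of the one-dimensional one. *)
Fixpoint lebesgue_tuple (R : realType) (n : nat) :
    {sigma_finite_measure set (n.-tuple R) -> \bar R} :=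
  if n is n'.+1 then lebesgue_step (lebesgue_tuple R n') else dirac [tuple].

Section inner_product.
Context {R : realType} {n : nat}.

Definition dot (u v : 'rV[R]_n) : R := \sum_i u 0 i * v 0 i.

Definition row_of_tuple (t : n.-tuple R) : 'rV[R]_n := \row_i tnth t i.

Lemma dot_ge0 v : 0 <= dot v v.
Proof. by apply: sumr_ge0 => i _; rewrite -expr2 sqr_ge0. Qed.

(* The coordinate-generated sigma-algebra of [n.-tuple R] contains the open
   sets of R^n. *)
Lemma open_measurable_row_of_tuple (W : set 'rV[R]_n) :
  open W -> measurable (row_of_tuple @^-1` W).
Proof.
move=> oW.
pose box (q : 'rV[rat]_n * nat) : set (n.-tuple R) :=
  [set t | forall i, `|ratr (q.1 0 i) - tnth t i| < q.2.+1%:R^-1].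
pose I : set ('rV[rat]_n * nat) := [set q | box q `<=` row_of_tuple @^-1` W].
rewrite (_ : _ @^-1` _ = \bigcup_(q in I) box q); last first.
  apply/seteqP; split => [t Wt|t [q Iq] bt]; last exact: Iq.
  have /nbhs_ballP[e /= e0 eW] : nbhs (row_of_tuple t) W by exact: open_nbhs_nbhs.
  have [k ke] : exists k : nat, k.+1%:R^-1 < e / 2.
    by have [k] := ltr_add_invr (divr_gt0 e0 (ltr0n _ 2)); rewrite add0r; exists k.
  have /choice[q qP] (i : 'I_n) :
      exists q : rat, `|ratr q - tnth t i| < k.+1%:R^-1 :> R.
    have lt : tnth t i - k.+1%:R^-1 < tnth t i + k.+1%:R^-1 :> R.
      by rewrite ltrD2l gtrN// invr_gt0.
    have [q] := rat_in_itvoo lt; rewrite in_itv/= => /andP[q1 q2].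
    by exists q; rewrite ltr_distl q1 q2.
  exists (\row_i q i, k) => [u /= bu|i /=]; last by rewrite mxE.
  apply: eW; rewrite /ball /= /mx_ball; split => // i j.
  rewrite !mxE /ball /= (le_lt_trans (ler_distD (ratr (q j)) _ _))//.
  rewrite [ltRHS]splitr ltrD//; first by rewrite distrC (lt_trans _ ke).
  by rewrite (lt_trans _ ke)//; have := bu j; rewrite mxE.
rewrite bigcup_mkcond; apply: countable_bigcupT_measurable.
  exact: countableP.
move=> q; case: ifPn => // _.
rewrite (_ : box q = \bigcap_i
    [set t | `|ratr (q.1 0 i) - tnth t i| < q.2.+1%:R^-1]); last first.
  by apply/seteqP; split => [t bt i _|t bt i] //; exact: bt.
apply: fin_bigcap_measurable => // i _.
rewrite -[X in measurable X]setTI.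
apply: (@measurable_tnth _ R n i measurableT
  (ball (ratr (q.1 0 i) : R) (q.2.+1%:R^-1))).
by apply: open_measurable; exact: ball_open.
Qed.

End inner_product.

Section sphere.
Context {R : realType}.

Definition unit_sphere (d : nat) : set 'rV[R]_d.+1 := [set x | dot x x = 1].

Definition sphere (d : nat) : Type := set_type (@unit_sphere d).

Variable d : nat.

HB.instance Definition _ := Topological.on (sphere d).

Lemma pole_subproof : delta_mx 0 ord0 \in @unit_sphere d.
Proof.
rewrite inE /unit_sphere /= /dot big_ord_recl big1 ?addr0 ?mxE ?eqxx ?mulr1//.
by move=> i _; rewrite !mxE /= mulr0.
Qed.

Definition Sphere (x : 'rV[R]_d.+1) (hx : x \in @unit_sphere d) : sphere d :=
  exist _ x hx.

HB.instance Definition _ := isPointed.Build (sphere d) (Sphere pole_subproof).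

(* Borel sigma-algebra *)
HB.instance Definition _ := @isMeasurable.Build (sigma_display (@open (sphere d)))
  (sphere d) <<s @open (sphere d) >>
  (@sigma_algebra0 _ setT _) (@sigma_algebraC _ _) (@sigma_algebra_bigcup _ setT _).

Lemma sphereP (x : sphere d) : dot (set_val x) (set_val x) = 1.
Proof. exact: set_valP x. Qed.

Lemma antipode_subproof (x : sphere d) : - set_val x \in @unit_sphere d.
Proof.
rewrite inE /unit_sphere /= -[RHS](sphereP x).
by apply: eq_bigr => i _; rewrite !mxE mulrNN.
Qed.

Definition antipode (x : sphere d) : sphere d := 
  Sphere (antipode_subproof x).

Definition geodesic_dist (x y : sphere d) : R := acos (dot (set_val x) (set_val y)).

Definition geodesic_ball (x : sphere d) (e : R) : set (sphere d) :=
  [set y | geodesic_dist x y < e].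

(* Inverse of the stereographic projection from the pole [e_0] (s = false) or
   [- e_0] (s = true), [e_0] being the first basis vector of R^(d+1). The two
   maps [stereo false] and [stereo true] parametrize the complements of these
   poles, and form the usual smooth atlas of S^d. *)
Definition stereo_vec (s : bool) (v : 'rV[R]_d) : 'rV[R]_d.+1 :=
  (1 + dot v v)^-1 *:
    (row_mx ((-1) ^+ s * (dot v v - 1))%:M (2 *: v) : 'rV_(1 + d)).

Lemma stereo_vec0 s v :
  stereo_vec s v 0 ord0 = (1 + dot v v)^-1 * ((-1) ^+ s * (dot v v - 1)).
Proof.
rewrite /stereo_vec mxE; congr (_ * _).
rewrite (_ : @ord0 d = @lshift 1 d ord0); last exact/val_inj.
by rewrite row_mxEl mxE eqxx mulr1n.
Qed.

Lemma stereo_vecS s v i :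
  stereo_vec s v 0 (lift ord0 i) = (1 + dot v v)^-1 * (2 * v 0 i).
Proof.
rewrite /stereo_vec mxE; congr (_ * _).
rewrite (_ : lift ord0 i = @rshift 1 d i); last exact/val_inj.
by rewrite row_mxEr mxE.
Qed.

Lemma stereo_subproof s v : stereo_vec s v \in @unit_sphere d.
Proof.
rewrite inE /unit_sphere /= /dot big_ord_recl stereo_vec0.
under eq_bigr do rewrite stereo_vecS.
have q0 : 1 + dot v v != 0 by rewrite gt_eqF// ltr_wpDr// dot_ge0.
set q := (1 + _)^-1.
rewrite (_ : \sum_i _ = q ^+ 2 * 4 * dot v v); last first.
  by rewrite /dot mulr_sumr; apply: eq_bigr => i _; ring.
rewrite mulrACA -expr2 -[X in _ * X + _]expr2 exprMn sqrr_sign mul1r /q.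
by field.
Qed.

Definition stereo (s : bool) (v : 'rV[R]_d) : sphere d :=
  Sphere (stereo_subproof s v).

End sphere.

Arguments sphere : clear implicits.

Section round_metric.
Context {R : realType} (d : nat).
Implicit Types (v : 'rV[R]_d) (s : bool).

(* First fundamental form of a parametrization: row i of the Jacobian is the
   i-th partial derivative, so entry (i, j) is the inner product of the i-th and
   j-th partial derivatives. *)
Definition pullback_metric n (phi : 'rV[R]_d -> 'rV[R]_n) v : 'M[R]_d :=
  'J phi v *m ('J phi v)^T.

Lemma dotp1_gt0 v : 0 < 1 + dot v v.
Proof. by rewrite ltr_wpDr// dot_ge0. Qed.


Lemma is_diff_ext (V W : normedModType R) (f g df dg : V -> W) (x : V) :
  is_diff x f df -> f =1 g -> df =1 dg -> is_diff x g dg.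
Proof. by move=> + /funext fg /funext dfg; rewrite fg dfg. Qed.

Lemma is_diff_coord i v :
  is_diff v (fun u : 'rV[R]_d => u 0 i) (fun u : 'rV[R]_d => u 0 i).
Proof.
have @f : {linear 'rV[R]_d -> R}.
  by exists (fun u : 'rV[R]_d => u 0 i); do 2![eexists]; do ?[constructor];
     rewrite ?mxE// => ? *; rewrite ?mxE//; move=> ?; rewrite !mxE.
have cf : continuous f by exact: coord_continuous.
apply: (@DiffDef _ _ _ _ _ f f); first exact: linear_differentiable.
by rewrite diff_lin.
Qed.

Lemma is_diff_sumf (V W : normedModType R) n (h dh : 'I_n -> V -> W) (x : V) :
  (forall i, is_diff x (h i) (dh i)) ->
  is_diff x (fun u => \sum_(i < n) h i u) (fun u => \sum_(i < n) dh i u).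
Proof.
move=> hdh.
rewrite (_ : (fun u => _) = \sum_(i < n) h i); last first.
  by apply/funext => u; rewrite fct_sumE.
rewrite [X in is_diff _ _ X](_ : _ = \sum_(i < n) dh i); last first.
  by apply/funext => u; rewrite fct_sumE.
by elim/big_ind2 : _ => // [|] *; [exact: is_diff_cst|exact: is_diffD].
Qed.

Lemma is_diff_inv (V : normedModType R) (f df : V -> R) (x : V) :
  f x != 0 -> is_diff x f df ->
  is_diff x (fun y => (f y)^-1) (fun y => - (f x) ^- 2 * df y).
Proof.
move=> fx0 dfx; apply: DiffDef; first exact: differentiableV.
by rewrite diffV//; apply/funext => y; rewrite diff_val.
Qed.

Lemma is_diff_scalel_fun (V W : normedModType R) (k dk : V -> R) (w : W) (x : V) :
  is_diff x k dk -> is_diff x (fun z => k z *: w) (fun z => dk z *: w).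
Proof.
move=> dkx; apply: DiffDef; first exact: differentiableZl.
by rewrite diffZl// diff_val.
Qed.

Lemma is_diff_dot v : is_diff v (fun u => dot u u) (fun h => 2 * dot v h).
Proof.
have D i := is_diffM (is_diff_coord i v) (is_diff_coord i v).
apply: is_diff_ext (is_diff_sumf D) _ _ => [//|h]; rewrite /dot mulr_sumr; apply: eq_bigr => i _ /=.
by rewrite mulr_natl mulr2n.
Qed.

Definition stereo_diff s v (h : 'rV[R]_d) : 'rV[R]_d.+1 :=
  (4 * (-1) ^+ s * dot v h / (1 + dot v v) ^+ 2) *: delta_mx 0 ord0 +
  \sum_(i < d) (2 * h 0 i / (1 + dot v v) -
    4 * v 0 i * dot v h / (1 + dot v v) ^+ 2) *: delta_mx 0 (lift ord0 i).

Lemma is_diff_stereo_vec s v : is_diff v (stereo_vec s) (stereo_diff s v).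
Proof.
have q0 : 1 + dot v v != 0 by rewrite gt_eqF// dotp1_gt0.
have Dq : is_diff v (fun u => 1 + dot u u) (fun h => 2 * dot v h).
  by apply: is_diff_ext (is_diffD (is_diff_cst (1 : R) v) (is_diff_dot v)) _ _
    => [//|h]; rewrite [LHS]add0r.
have Di := @is_diff_inv _ (fun u => 1 + dot u u) _ v q0 Dq.
rewrite (_ : stereo_vec s = fun u =>
   ((1 + dot u u)^-1 * ((-1) ^+ s * (dot u u - 1))) *: delta_mx 0 ord0 +
   \sum_(i < d) ((1 + dot u u)^-1 * (2 * u 0 i)) *: delta_mx 0 (lift ord0 i));
   last first.
  apply/funext => u; rewrite [LHS]row_sum_delta big_ord_recl stereo_vec0.
  by under eq_bigr do rewrite stereo_vecS.
apply: is_diffD.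
  apply: is_diff_scalel_fun.
  have D1 : is_diff v (fun u => (-1) ^+ s * (dot u u - 1))
      (fun h => (-1) ^+ s * (2 * dot v h)).
    apply: (@is_diffZ _ _ _ (fun u => dot u u - 1) (fun h => 2 * dot v h)).
    by apply: is_diff_ext (is_diffB (is_diff_dot v) (is_diff_cst (1 : R) v)) _ _
      => [//|h]; rewrite [LHS]subr0.
  apply: is_diff_ext (is_diffM Di D1) _ _ => [//|h].
  rewrite [LHS](_ : _ = (1 + dot v v)^-1 * ((-1) ^+ s * (2 * dot v h)) +
    ((-1) ^+ s * (dot v v - 1)) * (- (1 + dot v v) ^- 2 * (2 * dot v h)))//.
  by field.
apply: is_diff_sumf => i; apply: is_diff_scalel_fun.
have D1 : is_diff v (fun u : 'rV[R]_d => 2 * u 0 i) (fun h : 'rV[R]_d => 2 * h 0 i).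
  exact: (is_diffZ 2 (is_diff_coord i v)).
apply: is_diff_ext (is_diffM Di D1) _ _ => [//|h].
rewrite [LHS](_ : _ = (1 + dot v v)^-1 * (2 * h 0 i) +
    (2 * v 0 i) * (- (1 + dot v v) ^- 2 * (2 * dot v h)))//.
by field.
Qed.

Lemma pullback_metric_stereo s v :
  pullback_metric (stereo_vec s) v = ((2 / (1 + dot v v)) ^+ 2)%:M.
Proof.
have q0 : 1 + dot v v != 0 by rewrite gt_eqF// dotp1_gt0.
have Jh i : row i ('J (stereo_vec s) v) = stereo_diff s v (delta_mx 0 i).
  rewrite /jacobian rowE mul_rV_lin1.
  by have [_ ->] := is_diff_stereo_vec s v.
have dotd i : dot v (delta_mx 0 i) = v 0 i.
  rewrite /dot (bigD1 i)//= mxE !eqxx mulr1 big1 ?addr0// => j /negbTE ji.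
  by rewrite mxE ji andbF mulr0.
have J0 i : 'J (stereo_vec s) v i ord0 =
    4 * (-1) ^+ s * v 0 i / (1 + dot v v) ^+ 2.
  have /rowP/(_ ord0) := Jh i; rewrite mxE => ->.
  rewrite /stereo_diff dotd !mxE/= mulr1 summxE big1 ?addr0// => j _.
  by rewrite !mxE/= mulr0.
have JS i k : 'J (stereo_vec s) v i (lift ord0 k) =
    2 * (i == k)%:R / (1 + dot v v) - 4 * v 0 k * v 0 i / (1 + dot v v) ^+ 2.
  have /rowP/(_ (lift ord0 k)) := Jh i; rewrite mxE => ->.
  rewrite /stereo_diff dotd !mxE/= mulr0 add0r summxE (bigD1 k)//= big1 ?addr0.
    by rewrite !mxE !eqxx/= mulr1 eq_sym.
  move=> j /negbTE jk; by rewrite !mxE/= (inj_eq (@lift_inj _ ord0)) [k == j]eq_sym jk mulr0.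
have JT i k : ('J (stereo_vec s) v)^T k i = 'J (stereo_vec s) v i k by rewrite mxE.
apply/matrixP => i j; rewrite [LHS]mxE [RHS]mxE big_ord_recl JT !J0.
under eq_bigr do rewrite JT !JS.
have sumd (k : 'I_d) (F : 'I_d -> R) : \sum_l (k == l)%:R * F l = F k.
  rewrite (bigD1 k)//= eqxx mul1r big1 ?addr0// => l /negbTE lk.
  by rewrite eq_sym lk mul0r.
set q := 1 + dot v v in q0 *.
rewrite (_ : \sum_(k < d) _ = 4 / q ^+ 2 * (\sum_k (i == k)%:R * (j == k)%:R) -
  8 * v 0 j / q ^+ 3 * (\sum_k (i == k)%:R * v 0 k) -
  8 * v 0 i / q ^+ 3 * (\sum_k (j == k)%:R * v 0 k) +
  16 * v 0 i * v 0 j / q ^+ 4 * dot v v); last first.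
  rewrite /dot !mulr_sumr -!sumrB -big_split/=; apply: eq_bigr => k _.
  by field.
rewrite !sumd (_ : dot v v = q - 1); last by rewrite /q; ring.
have ss : (-1) ^+ s * (-1) ^+ s = 1 :> R by rewrite -expr2 sqrr_sign.
rewrite (_ : _ * _ * v 0 i / _ * _ = ((-1) ^+ s * (-1) ^+ s) *
  (16 * v 0 i * v 0 j / q ^+ 4)); last by field.
rewrite ss [j == i]eq_sym -[RHS]mulr_natr.
by field.
Qed.

Lemma volume_density_stereo s v :
  Num.sqrt (\det (pullback_metric (stereo_vec s) v)) = (2 / (1 + dot v v)) ^+ d.
Proof.
rewrite pullback_metric_stereo det_scalar -exprM mulnC exprM sqrtr_sqr.
by rewrite ger0_norm// exprn_ge0// divr_ge0// ltW// dotp1_gt0.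
Qed.

Lemma continuous_stereo_vec s : continuous (@stereo_vec R d s).
Proof. by move=> v; apply: differentiable_continuous; have [] := is_diff_stereo_vec s v. Qed.

Definition sphere_chart s (t : d.-tuple R) : sphere R d := stereo s (row_of_tuple t).

Lemma measurable_sphere_chart s : measurable_fun [set: d.-tuple R] (sphere_chart s).
Proof.
apply: (measurability (@open (sphere R d))) => //.
move=> _ [A [W oW <-] <-]; rewrite setTI.
apply: (@open_measurable_row_of_tuple _ _ (stereo_vec s @^-1` W)).
by apply: open_comp oW => v _; exact: continuous_stereo_vec.
Qed.

(* Riemannian volume of the round metric: integral of sqrt(det g) in the chart
   [stereo false], whose image omits a single point, which is negligible as soon
   as d > 0. (For d = 0 this would miss one of the two points of S^0.) *)
Definition sphere_volume (A : set (sphere R d)) : \bar R :=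
  (\int[lebesgue_tuple R d]_(t in sphere_chart false @^-1` A)
    (Num.sqrt (\det (pullback_metric (stereo_vec false) (row_of_tuple t))))%:E)%E.

Let density (t : d.-tuple R) : \bar R :=
  (Num.sqrt (\det (pullback_metric (stereo_vec false) (row_of_tuple t))))%:E.

Let measurable_density : measurable_fun [set: d.-tuple R] density.
Proof.
apply/measurable_EFinP.
pose g (v : 'rV[R]_d) : R := (2 / (1 + dot v v)) ^+ d.
rewrite (_ : (fun t => _) = g \o row_of_tuple); last first.
  by apply/funext => t; rewrite /= volume_density_stereo.
have cg : continuous g.
  move=> v; apply: (@continuous_comp _ _ _ (fun v => 2 / (1 + dot v v))
    (fun x : R => x ^+ d)); last exact: exprn_continuous.
  apply: continuousM; first exact: cst_continuous.
  apply: continuousV; first by rewrite gt_eqF// dotp1_gt0.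
  apply: continuousD; first exact: cst_continuous.
  by apply: differentiable_continuous; have [] := is_diff_dot v.
apply: (measurability _ (RGenOpens.measurableE R)).
move=> _ [_ [a [b ->] <-]]; rewrite setTI comp_preimage.
apply: open_measurable_row_of_tuple; apply: open_comp => [v _|]; first exact: cg.
exact: interval_open.
Qed.

Let sphere_volume0 : sphere_volume set0 = 0%E.
Proof. by rewrite /sphere_volume preimage_set0 integral_set0. Qed.

Let sphere_volume_ge0 A : (0 <= sphere_volume A)%E.
Proof. by apply: integral_ge0 => t _; rewrite lee_fin sqrtr_ge0. Qed.

Let sphere_volume_sigma_additive : semi_sigma_additive sphere_volume.
Proof.
move=> F mF tF mUF; rewrite /sphere_volume preimage_bigcup.
have mpF k : measurable (sphere_chart false @^-1` F k).
  by rewrite -[X in measurable X]setTI; exact: measurable_sphere_chart.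
rewrite ge0_integral_bigcup//; last 2 first.
- exact: measurable_funTS measurable_density.
- apply/trivIsetP => i j _ _ ij; rewrite -preimage_setI.
  by move/trivIsetP : tF => /(_ i j) ->//; rewrite preimage_set0.
apply: is_cvg_ereal_nneg_natsum => k _.
by apply: integral_ge0 => t _; rewrite lee_fin sqrtr_ge0.
Qed.

HB.instance Definition _ := isMeasure.Build _ _ _ sphere_volume
  sphere_volume0 sphere_volume_ge0 sphere_volume_sigma_additive.

End round_metric.

(* [f] is a density of [mu] with respect to the Riemannian volume measure; this
   makes [mu] absolutely continuous. *)
Definition is_density {R : realType} {d : nat}
    (mu : probability (sphere R d) R) (f : sphere R d -> R) : Prop :=
  [/\ measurable_fun [set: sphere R d] f,
      forall y, 0 <= f y &
      forall A : set (sphere R d), measurable A ->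
        mu A = (\int[@sphere_volume R d]_(y in A) (f y)%:E)%E].

Definition frechet_function {R : realType} {d : nat}
    (mu : probability (sphere R d) R) (x : sphere R d) : R :=
  \int[mu]_y (2^-1 * geodesic_dist y x ^+ 2).

(* [g] is [j] times Frechet differentiable on the open set [U]: the
   differential exists on [U] and, [V] being finite-dimensional in what follows,
   it is [j - 1] times differentiable as a map into linear forms iff its value at
   each vector [h] is. *)
Fixpoint differentiable_order {R : realType} {V : normedModType R} (j : nat)
    (U : set V) (g : V -> R) : Prop :=
  if j is j'.+1 then
    (forall x, U x -> differentiable g x) /\
    (forall h : V, differentiable_order j' U (fun x => 'd g x h))
  else True.

Definition sphere_differentiable_order {R : realType} {d : nat} (j : nat)
    (U : set (sphere R d)) (g : sphere R d -> R) : Prop :=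
  forall s : bool, differentiable_order j (stereo s @^-1` U) (g \o stereo s).

(* Main.v *)
(* Write x = stereo s v for the moving point and let r(y) = |y + x| be the chordal
   distance from y to the cut locus of x; then the integrand of the Frechet
   function is a function of <y, x> = r^2 / 2 - 1.

   One variable.  On (-1, 1], acos^2 / 2 is a power series in 1 - t of radius 2,
   hence smooth even at t = 1 (y = x), and the differential equation of
   acos t / sqrt (1 - t^2) gives |(acos^2 / 2)^(m)(t)| <= C (1 + t)^(1/2 - m).  The
   derivative of <y, x> in v is O(r), because <x, dx> = 0; so after subtraction of
   pi^2 / 2 the integrand is O(r), and each derivative in v costs a factor 1 / r.

   Differentiation under the integral.  If k = O(r^(1 - m)) loses one power of r
   with each derivative, then
     |k(v + h) - k(v) - Dk(v) h|
       <= C |h|^(5/4) (r_v^(-m - 1/4) + r_(v + h)^(-m - 1/4)),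
   by Taylor's formula where r_v >= 2 L |h| and by the bounds on k and Dk elsewhere.
   So it is enough that the integrals of r_v^(-m - 1/4) are bounded uniformly in v.

   Mass of small caps.  Cutting R^d into the shells 16^k <= 1 + |t|^2 < 16^(k+1)
   shows that a cap of radius rho has volume at most C rho^(d - 1/2), which makes
   these integrals bounded for m <= d - 1. *)
Require Import Defs.
From mathcomp Require Import all_boot all_order all_algebra.
From mathcomp Require Import all_classical all_reals all_analysis.
From mathcomp Require Import measurable_realfun.
From mathcomp Require Import ring lra.

Set Implicit Arguments.
Unset Strict Implicit.
Unset Printing Implicit Defensive.

Import Order.TTheory GRing.Theory Num.Theory.
Import numFieldNormedType.Exports.

Local Open Scope classical_set_scope.
Local Open Scope ring_scope.

(** * Differentials from estimates, and in coordinates *)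

(** The hypothesis [is_diff x L L] encodes that [L] is linear and continuous: it is its own
    differential. *)
Lemma is_diff_of_estimate {R : realType} (V W : normedModType R) (g L : V -> W)
    (x : V) : is_diff x L L ->
  (forall e : R, 0 < e ->
    \forall h \near (0 : V), `|g (h + x) - g x - L h| <= e * `|h|) ->
  is_diff x g L.
Proof.
move=> [dl dE] H.
have H1 : g \o shift x = cst (g x) + 'd L x +o_ 0 id.
  apply/eqaddoP => e e0; apply: filterS (H e e0) => h.
  by rewrite !fctE /= dE opprD addrA.
have cl : continuous ('d L x) by exact: diff_continuous.
have E := diff_unique cl H1.
apply: DiffDef; last by rewrite E dE.
by apply/diff_locallyP; rewrite E; split.
Qed.

Section linear_form.
Context {R : realType} {d : nat}.
Implicit Types (c : 'I_d -> R) (h x : 'rV[R]_d).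

Definition linform c h : R := \sum_i h 0 i * c i.

Lemma is_diff_linform c x : is_diff x (linform c) (linform c).
Proof.
have D i : is_diff x (fun u : 'rV[R]_d => u 0 i * c i) (fun u => u 0 i * c i).
  apply: is_diff_ext (is_diffM (is_diff_coord i x) (is_diff_cst (c i) x)) _ _
    => [//|u].
  by rewrite /cst [LHS](_ : _ = x 0 i * 0 + c i * u 0 i)//; ring.
exact: is_diff_sumf D.
Qed.

Lemma le_coord_norm h i : `|h 0 i| <= `|h|.
Proof.
rewrite [leRHS]mx_normrE.
exact: (@le_bigmax _ _ _ 0 (fun k => `|h k.1 k.2|) (0, i)).
Qed.

Lemma le_linform c h : `|linform c h| <= `|h| * \sum_i `|c i|.
Proof.
rewrite mulr_sumr (le_trans (ler_norm_sum _ _ _))//; apply: ler_sum => i _.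
by rewrite normrM ler_wpM2r// le_coord_norm.
Qed.

End linear_form.

(** * Kernels with a power singularity *)

Section kernels.
Context {R : realType} {d : nat} {disp : measure_display}
  {S : measurableType disp}.
Variables (U : set 'rV[R]_d) (r : 'rV[R]_d -> S -> R).
Implicit Types (k : 'rV[R]_d -> S -> R) (e : int) (n : nat).

(* [s] is the exponent lost with each derivative: 1 for the kernels with a power
   singularity on [r = 0], 0 for smooth bounded ones. *)
Fixpoint kernel (s : int) n e k : Prop :=
  [/\ forall v, measurable_fun setT (k v),
      exists C, forall v y, U v -> 0 < r v y -> `|k v y| <= C * r v y ^ e &
      if n is n'.+1 then
        exists Dk : 'I_d -> 'rV[R]_d -> S -> R,
          (forall i, kernel s n' (e - s) (Dk i)) /\
          (forall v y, U v -> 0 < r v y ->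
             is_diff v (k^~ y) (linform (fun i => Dk i v y)))
      else True].

Lemma kernelW s n e k : kernel s n.+1 e k -> kernel s n e k.
Proof.
elim: n => [|n IH] in e k *; first by case.
move=> [mk bk [Dk [kD dk]]]; split => //; exists Dk; split => // i.
exact/IH/kD.
Qed.

Lemma kernel_base s n e k : kernel s n e k -> kernel s 0 e k.
Proof. by elim: n => // n IH /kernelW. Qed.

Lemma kernelD s n e k1 k2 : kernel s n e k1 -> kernel s n e k2 ->
  kernel s n e (fun v y => k1 v y + k2 v y).
Proof.
elim: n => [|n IH] in e k1 k2 *.
  move=> [m1 [C1 b1] _] [m2 [C2 b2] _]; split => //.
    by move=> v; exact: measurable_funD.
  exists (C1 + C2) => v y Uv ry; rewrite mulrDl.
  by rewrite (le_trans (ler_normD _ _))// lerD// (b1, b2).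
(* Measurability and the size bound do not involve the number of derivatives, so they come from the
   induction hypothesis at order [n]. *)
move=> K1 K2; have [m3 b3 _] := kernel_base (IH _ _ _ (kernelW K1) (kernelW K2)).
move: K1 K2 => [_ _ [Dk1 [D1 dk1]]] [_ _ [Dk2 [D2 dk2]]].
split => //; exists (fun i v y => Dk1 i v y + Dk2 i v y); split => [i|v y Uv ry].
  exact: IH (D1 i) (D2 i).
apply: is_diff_ext (is_diffD (dk1 v y Uv ry) (dk2 v y Uv ry)) _ _ => [//|h].
rewrite fctE /linform -big_split/=; apply: eq_bigr => i _.
by rewrite mulrDr.
Qed.

Lemma kernelM s n e1 e2 k1 k2 : kernel s n e1 k1 -> kernel s n e2 k2 ->
  kernel s n (e1 + e2) (fun v y => k1 v y * k2 v y).
Proof.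
elim: n => [|n IH] in e1 e2 k1 k2 *.
  move=> [m1 [C1 b1] _] [m2 [C2 b2] _]; split => //.
    by move=> v; exact: measurable_funM.
  exists (C1 * C2) => v y Uv ry; rewrite expfzDr ?gt_eqF// mulrACA normrM.
  by rewrite ler_pM// (b1, b2).
move=> K1 K2; have [m3 b3 _] := kernel_base (IH _ _ _ _ (kernelW K1) (kernelW K2)).
have K1' := kernelW K1; have K2' := kernelW K2.
move: K1 K2 => [_ _ [Dk1 [D1 dk1]]] [_ _ [Dk2 [D2 dk2]]].
split => //; exists (fun i v y => Dk1 i v y * k2 v y + k1 v y * Dk2 i v y).
split => [i|v y Uv ry].
  apply: kernelD; first by rewrite addrAC; exact: IH (D1 i) K2'.
  by rewrite -addrA; exact: IH K1' (D2 i).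
apply: is_diff_ext (is_diffM (dk1 v y Uv ry) (dk2 v y Uv ry)) _ _ => [//|h].
rewrite [LHS](_ : _ = k1 v y * linform (Dk2 ^~ v ^~ y) h +
  k2 v y * linform (Dk1 ^~ v ^~ y) h)// /linform !mulr_sumr -big_split/=.
by apply: eq_bigr => i _; ring.
Qed.

Lemma kernel_ext s n e k1 k2 : (forall v y, k1 v y = k2 v y) ->
  kernel s n e k1 -> kernel s n e k2.
Proof. by move=> H; rewrite (_ : k1 = k2)//; apply/funext => v; apply/funext. Qed.

Lemma kernel_param n (c : S -> R) : measurable_fun setT c ->
  (exists C, forall y, `|c y| <= C) -> kernel 0 n 0 (fun _ => c).
Proof.
elim: n c => [|n IH] c mc [C bC]; split => //.
- by exists C => v y _ _; rewrite expr0z mulr1.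
- by exists C => v y _ _; rewrite expr0z mulr1.
exists (fun _ _ => cst 0); split => [i|v y _ _].
  by rewrite subr0; apply: IH => //; exists 0 => y; rewrite normr0.
apply: is_diff_ext (is_diff_cst (c y) v) _ _ => [//|h].
by rewrite /linform big1// => i _; rewrite mulr0.
Qed.

Lemma kernel0 s n e : kernel s n e (fun _ _ => 0).
Proof.
elim: n e => [|n IH] e; split => //.
- by exists 0 => v y _ _; rewrite normr0 mul0r.
- by exists 0 => v y _ _; rewrite normr0 mul0r.
exists (fun _ _ _ => 0); split => // v y _ _.
apply: is_diff_ext (is_diff_cst (0 : R) v) _ _ => [//|h].
by rewrite /linform big1// => i _; rewrite mulr0.
Qed.

Lemma kernelZ s n e a k : kernel s n e k -> kernel s n e (fun v y => a * k v y).
Proof.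
elim: n e k => [|n IH] e k.
  move=> [mk [C bk] _]; split => //.
    by move=> v; exact: measurable_funM.
  exists (`|a| * C) => v y Uv ry; rewrite normrM -mulrA ler_wpM2l//.
  exact: bk.
move=> K; have [mk bk _] := kernel_base (IH _ _ (kernelW K)).
case: K => _ _ [Dk [kD dk]]; split => //.
exists (fun i v y => a * Dk i v y); split => [i|v y Uv ry]; first exact/IH/kD.
apply: is_diff_ext (is_diffZ a (dk v y Uv ry)) _ _ => [//|h].
rewrite [LHS](_ : _ = a * linform (Dk ^~ v ^~ y) h)// /linform mulr_sumr.
by apply: eq_bigr => i _; rewrite mulrCA.
Qed.

Lemma kernel_sum s n e m (k : 'I_m -> 'rV[R]_d -> S -> R) :
  (forall i, kernel s n e (k i)) -> kernel s n e (fun v y => \sum_i k i v y).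
Proof.
elim: m k => [|m IH] k H.
  by apply: (kernel_ext _ (kernel0 s n e)) => v y; rewrite big_ord0.
apply: (@kernel_ext _ _ _ (fun v y => k ord0 v y + \sum_i k (lift ord0 i) v y)).
  by move=> v y; rewrite big_ord_recl.
by apply: kernelD => //; exact: IH.
Qed.

(** As [r <= 2], a function bounded by C is at most C 2^(-e) r^e when e <= 0. Each derivative lowers
    the exponent further, so the sign condition persists through the induction. *)
Lemma kernel_step n e k : (forall v y, U v -> r v y <= 2) ->
  e <= 0 -> kernel 0 n 0 k -> kernel 1 n e k.
Proof.
move=> r2; elim: n e k => [|n IH] e k e0 K; last first.
  have [mk bk _] := kernel_base (IH _ _ e0 (kernelW K)).
  case: K => _ _ [Dk [kD dk]].
  split => //; exists Dk; split => // i; move: (kD i); rewrite subr0; apply: IH.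
  by rewrite subr_le0 (le_trans e0).
case: K => mk [C bk] _; split => //.
exists (`|C| * 2 ^ (- e)) => v y Uv ry.
rewrite (le_trans (bk v y Uv ry))// expr0z mulr1 (le_trans (ler_norm _))//.
rewrite -mulrA ler_peMr//; case: e e0 => [[|m]|m] // _.
  by rewrite oppr0 !expr0z mulr1.
rewrite -[2 ^ _]/(2 ^+ m.+1) -[_ ^ Negz m]/((r v y ^+ m.+1)^-1) -expr_div_n.
by rewrite exprn_ege1// ler_pdivlMr// mul1r r2.
Qed.

End kernels.

(** * Taylor's formula on [0, 1] and fourth roots *)

Section one_variable.
Context {R : realType}.
Implicit Types (f g : R -> R) (x : R).

Lemma is_diff_is_derive1 f df x : is_diff x f df -> is_derive x 1 f (df 1).
Proof.
move=> [dfx dfE]; apply: DeriveDef; first exact: diff_derivable.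
by rewrite deriveE// dfE.
Qed.

Lemma is_derive1_continuous f x l : is_derive x 1 f l -> {for x, continuous f}.
Proof. by move=> [dfx _]; exact/differentiable_continuous/derivable1_diffP. Qed.

(** The mean value theorem twice: g(1) - g(0) = g1(c), then g1(c) - g1(0) = c g2(b) with 0 <= c <=
    1. *)
Lemma taylor2_01 g g1 g2 (B : R) :
  (forall t : R, 0 <= t <= 1 -> is_derive t 1 g (g1 t)) ->
  (forall t : R, 0 <= t <= 1 -> is_derive t 1 g1 (g2 t)) ->
  (forall t : R, 0 <= t <= 1 -> `|g2 t| <= B) ->
  `|g 1 - g 0 - g1 0| <= B.
Proof.
move=> dg dg1 gB.
have cw (f f1 : R -> R) (c : R) : 0 <= c <= 1 ->
    (forall t : R, 0 <= t <= 1 -> is_derive t 1 f (f1 t)) ->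
    {within `[0, c], continuous f}.
  move=> /andP[c0 c1] df; apply: continuous_in_subspaceT => t.
  rewrite inE/= in_itv/= => /andP[t0 tc].
  by apply: is_derive1_continuous (df t _); rewrite t0 (le_trans tc).
have inI (c t : R) : 0 <= c <= 1 -> t \in `]0, c[%R -> 0 <= t <= 1.
  rewrite in_itv/= => /andP[c0 c1] /andP[t0 tc].
  by rewrite ltW//= (le_trans (ltW tc)).
have I1 : 0 <= (1 : R) <= 1 by rewrite lexx ler01.
have [c] := MVT_segment ler01 (fun t It => dg t (inI 1 t I1 It)) (cw _ _ 1 I1 dg).
rewrite in_itv/= => Ic ->; rewrite subr0 mulr1.
have c0 : 0 <= c by case/andP: Ic.
have [b] := MVT_segment c0 (fun t It => dg1 t (inI c t Ic It)) (cw _ _ c Ic dg1).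
rewrite in_itv/= => /andP[b0 bc] ->.
have /andP[_ c1] := Ic.
rewrite subr0 normrM (ger0_norm c0) (le_trans _ (gB b _))//.
  by rewrite ler_piMr.
by rewrite b0 (le_trans bc).
Qed.

(** A quarter power is the margin used throughout: |h|^(1/4) turns a remainder O(|h|^(5/4)) into
    o(|h|), while r^(-m - 1/4) stays integrable when caps of radius rho have mass O(rho^(m +
    1/2)). *)
Definition root4 x : R := Num.sqrt (Num.sqrt x).

Lemma root4_ge0 x : 0 <= root4 x. Proof. exact: sqrtr_ge0. Qed.

Lemma root4_gt0 x : 0 < x -> 0 < root4 x.
Proof. by move=> x0; rewrite !sqrtr_gt0. Qed.

Lemma root4K x : 0 <= x -> root4 x ^+ 4 = x.
Proof. by move=> x0; rewrite -[4%N]/(2 * 2)%N exprM !sqr_sqrtr ?sqrtr_ge0. Qed.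

Lemma root4M x y : 0 <= x -> root4 (x * y) = root4 x * root4 y.
Proof. by move=> x0; rewrite /root4 sqrtrM// sqrtrM// sqrtr_ge0. Qed.

Lemma le_root4 x y : x <= y -> root4 x <= root4 y.
Proof. by move=> xy; apply/ler_wsqrtr/ler_wsqrtr. Qed.

(** After division by (x y)^(1/4) this is the monotonicity of the power 3/4. *)
Lemma mul_root4_le x y : 0 <= x <= y -> x * root4 y <= y * root4 x.
Proof.
move=> /andP[x0 xy]; have y0 := le_trans x0 xy.
rewrite -{1}(root4K x0) -{2}(root4K y0).
have a0 := root4_ge0 x; have ab := le_root4 xy; have b0 := root4_ge0 y.
rewrite !exprS expr0 mulr1.
set a := root4 x in a0 ab *; set b := root4 y in ab b0 *.
rewrite [leLHS](_ : _ = a * a * a * (a * b)); last by ring.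
rewrite [leRHS](_ : _ = b * b * b * (a * b)); last by ring.
rewrite ler_wpM2r ?mulr_ge0//.
by rewrite ler_pM ?mulr_ge0// ler_pM.
Qed.

End one_variable.

(** * First-order Taylor estimate for singular kernels *)

Section kernel_estimate.
Context {R : realType} {d : nat} {disp : measure_display}
  {S : measurableType disp}.
Variables (U : set 'rV[R]_d) (r : 'rV[R]_d -> S -> R).

Lemma kernel_bounds (I : finType) s n e (k : I -> 'rV[R]_d -> S -> R) :
  (forall i, kernel U r s n e (k i)) ->
  exists C, 0 <= C /\ forall i v y, U v -> 0 < r v y ->
    `|k i v y| <= C * r v y ^ e.
Proof.
move=> H.
have /choice[C bC] i : exists C, forall v y, U v -> 0 < r v y ->
    `|k i v y| <= C * r v y ^ e.
  by have [_ [C ?] _] := kernel_base (H i); exists C.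
exists (\sum_i `|C i|); split => [|i v y Uv ry]; first exact: sumr_ge0.
rewrite (le_trans (bC i v y Uv ry))// ler_wpM2r//.
  exact/exprz_ge0/ltW.
by rewrite (le_trans (ler_norm _))// (bigD1 i)//= lerDl sumr_ge0.
Qed.

Lemma is_derive_line (k : 'rV[R]_d -> R) (c : 'I_d -> R) v h (t : R) :
  is_diff (v + t *: h) k (linform c) ->
  is_derive t 1 (fun t => k (v + t *: h)) (linform c h).
Proof.
move=> dk.
have dl : is_diff t (fun t : R => v + t *: h) (fun t => t *: h).
  have := is_diffD (is_diff_cst v t) (is_diff_scalel_fun h (is_diff_id t)).
  by move=> D; apply: is_diff_ext D _ _ => [//|u]; rewrite [LHS]add0r.
have := is_diff_is_derive1 (is_diff_comp dl dk).
by rewrite /= scale1r.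
Qed.

(** [rL] is the Lipschitz condition r_v <= r_v' + L |v - v'|, squared and weakened by (a + b)^2 <= 2
    a^2 + 2 b^2. In this form it can be checked on sums of squares. *)
Variable L : R.
Hypotheses (L1 : 1 <= L)
  (rL : forall v v' y,
    r v y ^+ 2 <= 2 * r v' y ^+ 2 + 2 * (L * `|v - v'|) ^+ 2)
  (r_ge0 : forall v y, 0 <= r v y).

(** The power x^(-m - 1/4); the convention for inverses makes it 0 at x = 0. *)
Definition singular_weight m (x : R) : R := (x ^+ m * root4 x)^-1.

Local Notation w := singular_weight.

Lemma singular_weight_ge0 m x : 0 <= x -> 0 <= w m x.
Proof. by move=> x0; rewrite invr_ge0 mulr_ge0 ?exprn_ge0 ?root4_ge0. Qed.

Lemma expz_weight (m : nat) x : 0 < x -> x ^ (- m%:Z) = root4 x * w m x.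
Proof.
move=> x0; rewrite -exprz_inv -[_ ^ _]/(_ ^+ _) exprVn /w.
have r0 := root4_gt0 x0; have xm0 := exprn_gt0 m x0; field.
by rewrite !gt_eqF.
Qed.

(** Far from the singular set, relative to |h|, second derivatives control the remainder. Close to
    it the three terms are bounded one by one, and [k (v + h) y] brings in the weight at the other
    end. *)
Lemma kernel_taylor n m k Dk :
  (exists C, forall v y, U v -> 0 < r v y -> `|k v y| <= C * r v y ^ (1 - m%:Z)) ->
  (forall i, kernel U r 1 n.+1 (- m%:Z) (Dk i)) ->
  (forall v y, U v -> 0 < r v y ->
             is_diff v (k^~ y) (linform (fun i => Dk i v y))) ->
  exists C, 0 <= C /\ forall (v h : 'rV[R]_d) (y : S),
    (forall t : R, 0 <= t <= 1 -> U (v + t *: h)) ->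
    0 < r v y -> 0 < r (v + h) y ->
    `|k (v + h) y - k v y - linform (fun i => Dk i v y) h| <=
      C * (`|h| * root4 `|h|) * (w m (r v y) + w m (r (v + h) y)).
Proof.
move=> [C0 b0] kD dk.
have [C1 [C1_ge0 b1]] := kernel_bounds kD.
have /choice[D2 D2P] i : exists D2 : 'I_d -> 'rV[R]_d -> S -> R,
  (forall l, kernel U r 1 n (- m%:Z - 1) (D2 l)) /\
  (forall v y, U v -> 0 < r v y ->
             is_diff v (Dk i ^~ y) (linform (fun l => D2 l v y))).
  by have [_ _] := kD i.
have [C2 [C2_ge0 b2]] :=
  @kernel_bounds ('I_d * 'I_d)%type _ _ _ (fun il => D2 il.1 il.2)
  (fun il => (D2P il.1).1 il.2).
(* The first summand serves the Taylor case; the other two bound the linear term and the two values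
   of [k] in the singular case. *)
pose K := (d%:R ^+ 2 * C2 * 2 ^+ m.+1) + (d%:R * C1 * root4 (4 * L)) +
  (`|C0| * (4 * L) * root4 (4 * L)).
have L0 : 0 <= L by rewrite (le_trans ler01).
have r4L := root4_ge0 (4 * L).
exists K; split => [|v h y Uvh ry rhy].
  by rewrite !addr_ge0// !mulr_ge0// ?exprn_ge0// ?mulr_ge0.
have Uv : U v by have := Uvh 0; rewrite scale0r addr0 lexx ler01; exact.
have Uh : U (v + h) by have := Uvh 1; rewrite scale1r lexx ler01; exact.
have b0w u : U u -> 0 < r u y ->
    `|k u y| <= `|C0| * (r u y * root4 (r u y) * w m (r u y)).
  move=> Uu ru; rewrite (le_trans (b0 u y Uu ru))//.
  rewrite expfzDr ?gt_eqF// expr1z expz_weight// -mulrA ler_wpM2r ?ler_norm//.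
  by rewrite !mulr_ge0 ?root4_ge0// ?singular_weight_ge0// ltW.
have b1w : `|linform (fun i => Dk i v y) h| <=
    `|h| * (d%:R * C1 * (root4 (r v y) * w m (r v y))).
  rewrite (le_trans (le_linform _ _))// ler_wpM2l// -expz_weight//.
  rewrite -mulrA mulr_natl -[X in _ *+ X]card_ord -sumr_const.
  by apply: ler_sum => i _; exact: b1.
set a := `|h| in b1w *; have a0 : 0 <= a by exact: normr_ge0.
set x := r v y in ry b1w *; set x' := r (v + h) y in rhy *.
have wx : 0 <= w m x by apply/singular_weight_ge0/ltW.
have wx' : 0 <= w m x' by apply/singular_weight_ge0/ltW.
have ra0 := root4_ge0 a.
(* Here [rL] gives x^2 <= 2 r_t^2 + 2 (L a)^2 <= 2 r_t^2 + x^2 / 2, so r is at least x / 2 along the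
   whole segment and the second derivatives are O(x^(-m - 1)) there. *)
have [ax|xa] := leP (2 * L * a) x.
  have La0 := mulr_ge0 L0 a0.
  have rx2 (t : R) : 0 <= t <= 1 -> x / 2 <= r (v + t *: h) y.
    move=> /andP[t0 t1].
    rewrite -(@ler_pXn2r _ 2)// ?nnegrE ?r_ge0//; last by rewrite divr_ge0// ltW.
    have := rL v (v + t *: h) y.
    rewrite opprD addrA subrr add0r normrN normrZ (ger0_norm t0) -/x -/a => H1.
    have H2 : (L * (t * a)) ^+ 2 <= (L * a) ^+ 2.
      rewrite ler_pXn2r ?nnegrE// ?mulr_ge0// ler_wpM2l// ler_piMl//.
    have H3 : (2 * L * a) ^+ 2 <= x ^+ 2.
      by rewrite ler_pXn2r ?nnegrE// ?mulr_ge0// ltW.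
    rewrite (_ : (2 * L * a) ^+ 2 = 4 * (L * a) ^+ 2) in H3; last by ring.
    rewrite (_ : (x / 2) ^+ 2 = x ^+ 2 / 4); last by field.
    lra.
  have rgt0 (t : R) : 0 <= t <= 1 -> 0 < r (v + t *: h) y.
    by move=> /rx2; apply: lt_le_trans; rewrite divr_gt0.
  pose g2 (t : R) := linform (fun l =>
    linform (fun i => D2 i l (v + t *: h) y) h) h.
  have dg (t : R) : 0 <= t <= 1 -> is_derive t 1 (fun t : R => k (v + t *: h) y)
      (linform (fun i => Dk i (v + t *: h) y) h).
    move=> It; apply: (@is_derive_line (k^~ y) (fun i => Dk i (v + t *: h) y)).
    by apply: dk; [exact: Uvh|exact: rgt0].
  have dg1 (t : R) : 0 <= t <= 1 ->
      is_derive t 1 (fun t : R => linform (fun i => Dk i (v + t *: h) y) h) (g2 t).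
    move=> It; apply: (@is_derive_line (fun w => linform (fun i => Dk i w y) h)
      (fun l => linform (fun i => D2 i l (v + t *: h) y) h)).
    have D i := is_diffZ (h 0 i) ((D2P i).2 _ y (Uvh t It) (rgt0 t It)).
    apply: is_diff_ext (is_diff_sumf D) _ _ => [//|u].
    rewrite [LHS](_ : _ = \sum_i h 0 i * \sum_l u 0 l * D2 i l (v + t *: h) y)//.
    under eq_bigr do rewrite mulr_sumr.
    rewrite /linform exchange_big/=; apply: eq_bigr => l _.
    by rewrite mulr_sumr; apply: eq_bigr => i _; rewrite mulrCA.
  have bg2 (t : R) : 0 <= t <= 1 ->
      `|g2 t| <= a * (\sum_(l < d) a * \sum_(i < d) C2 * (x / 2) ^- m.+1).
    move=> It; rewrite (le_trans (le_linform _ _))// ler_wpM2l//.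
    apply: ler_sum => l _; rewrite (le_trans (le_linform _ _))// ler_wpM2l//.
    apply: ler_sum => i _.
    rewrite (le_trans (b2 (i, l) _ y (Uvh t It) (rgt0 t It)))// ler_wpM2l//.
    rewrite (_ : - m%:Z - 1 = - m.+1%:Z); last by rewrite -opprD -PoszD addn1.
    rewrite -exprz_inv -[_ ^ _]/(_ ^+ _) exprVn lef_pV2 ?posrE ?exprn_gt0//.
    + by rewrite ler_pXn2r// ?nnegrE ?rx2// ?r_ge0// divr_ge0// ltW.
    + exact: rgt0.
    + by rewrite divr_gt0.
  have := taylor2_01 dg dg1 bg2.
  rewrite scale1r scale0r addr0 => /le_trans; apply.
  have sumd (z : R) : \sum_(i < d) z = d%:R * z.
    by rewrite sumr_const card_ord mulr_natl.
  rewrite 2!sumd.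
  have D0 : 0 <= d%:R * C1 * root4 (4 * L) + `|C0| * (4 * L) * root4 (4 * L).
    by rewrite addr_ge0// !mulr_ge0.
  (* As a <= x, the excess factor (a / x)^(3/4) is at most 1. *)
  have [x0 aw] : x != 0 /\ a ^+ 2 * x ^- m.+1 <= a * root4 a * w m x.
    rewrite gt_eqF//; split => //; rewrite expr2 -!mulrA ler_wpM2l//.
    rewrite ler_pdivrMr ?exprn_gt0// /w exprSr.
    have r0 := root4_gt0 ry; have xm0 := exprn_gt0 m ry.
    rewrite [leRHS](_ : _ = x * root4 a / root4 x); last first.
      by field; rewrite !gt_eqF.
    rewrite ler_pdivlMr// mul_root4_le// a0 (le_trans _ ax)// ler_peMl//.
    by move: L1; lra.
  rewrite [leLHS](_ : _ = d%:R ^+ 2 * C2 * 2 ^+ m.+1 * (a ^+ 2 * x ^- m.+1)).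
    rewrite (le_trans (ler_wpM2l _ aw))//; first by rewrite !mulr_ge0// exprn_ge0.
    rewrite mulrA mulrA.
    set A := d%:R ^+ 2 * C2 * _.
    have A0 : 0 <= A by rewrite !mulr_ge0// exprn_ge0.
    have w2 : 0 <= w m x + w m x' by exact: addr_ge0.
    have aa : 0 <= a * root4 a by exact: mulr_ge0.
    rewrite (le_trans (_ : _ <= A * a * root4 a * (w m x + w m x')))//.
      by rewrite ler_wpM2l ?lerDl// !mulr_ge0.
    rewrite -[leLHS]mulrA -[leLHS]mulrA [_ * (root4 _ * _)]mulrA mulrA.
    by rewrite ler_wpM2r// ler_wpM2r// /K -addrA lerDl.
  rewrite exprMn exprVn.
  have x20 : x ^+ m.+1 != 0 by rewrite expf_neq0.
  have t20 : (2 : R) ^+ m.+1 != 0 by rewrite expf_neq0.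
  by field; rewrite x20 t20.
(* Singular case: both distances are O(a), so a bound by r^(1 - m) = r r^(1/4) r^(-m - 1/4) is
   already O(a^(5/4)) times the weight. *)
have x4 : x <= 4 * L * a.
  by have La := mulr_ge0 L0 a0; move: xa; lra.
have x'4 : x' <= 4 * L * a.
  rewrite -(@ler_pXn2r _ 2)// ?nnegrE ?mulr_ge0// ?r_ge0// /x'.
  rewrite (le_trans (rL (v + h) v y))// -/x [v + h]addrC addrK -/a.
  have : x ^+ 2 <= (2 * L * a) ^+ 2 by rewrite ler_pXn2r// ?nnegrE ?mulr_ge0// ?r_ge0// ltW.
  by rewrite !exprMn; nra.
have rx : root4 x <= root4 (4 * L) * root4 a by rewrite -root4M ?mulr_ge0 ?le_root4.
have rx' : root4 x' <= root4 (4 * L) * root4 a.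
  by rewrite -root4M ?mulr_ge0 ?le_root4.
have B0 : `|k v y| <= `|C0| * (4 * L) * root4 (4 * L) * (a * root4 a) * w m x.
  rewrite (le_trans (b0w v Uv ry))// -/x.
  rewrite -!mulrA ler_wpM2l// !mulrA ler_wpM2r//.
  rewrite [leRHS](_ : _ = (4 * L * a) * (root4 (4 * L) * root4 a)); last by ring.
  by rewrite ler_pM// ?root4_ge0// ltW.
have B0' : `|k (v + h) y| <= `|C0| * (4 * L) * root4 (4 * L) * (a * root4 a) * w m x'.
  rewrite (le_trans (b0w _ Uh rhy))// -/x'.
  rewrite -!mulrA ler_wpM2l// !mulrA ler_wpM2r//.
  rewrite [leRHS](_ : _ = (4 * L * a) * (root4 (4 * L) * root4 a)); last by ring.
  by rewrite ler_pM// ?root4_ge0// ltW.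
have B1 : `|linform (fun i => Dk i v y) h| <=
    d%:R * C1 * root4 (4 * L) * (a * root4 a) * w m x.
  rewrite (le_trans b1w)// [leRHS](_ : _ = a * (d%:R * C1 *
    (root4 (4 * L) * root4 a * w m x))); last by ring.
  by rewrite ler_wpM2l// ler_wpM2l ?mulr_ge0// ler_wpM2r.
rewrite (le_trans (ler_normB _ _))// (le_trans (lerD (ler_normB _ _) (lexx _)))//.
rewrite (le_trans (lerD (lerD B0' B0) B1))//.
set A := `|C0| * _ * _; set B := d%:R * C1 * _.
have A0 : 0 <= A by rewrite !mulr_ge0.
have BB0 : 0 <= B by rewrite !mulr_ge0.
have D0 : 0 <= d%:R ^+ 2 * C2 * 2 ^+ m.+1 by rewrite !mulr_ge0// exprn_ge0.
rewrite /K -/A -/B; set D := _ * 2 ^+ _ in D0 *.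
rewrite [leRHS](_ : _ = A * (a * root4 a) * w m x' + A * (a * root4 a) * w m x +
  B * (a * root4 a) * w m x + (B * (a * root4 a) * w m x' +
  D * (a * root4 a) * (w m x + w m x'))); last by ring.
by rewrite lerDl !addr_ge0// !mulr_ge0// addr_ge0.
Qed.

End kernel_estimate.

(** * Integrals of the singular weight *)

Section layer_weight.
Context {R : realType} {disp : measure_display} {S : measurableType disp}.
Variables (q : nat) (phi : S -> R).
Hypothesis mphi : measurable_fun setT phi.

(** Powers of 16 are used because the square and fourth roots of [16 ^+ l] are the integers [4 ^+ l]
    and [2 ^+ l]. *)
Definition layer l : set S := [set y | phi y < 16 / 16 ^+ l].

(* A majorant of [singular_weight q \o phi] that is +oo where [phi] vanishes, so that
   the cut locus need not be removed from the domain of integration. *)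
Definition layer_weight (y : S) : \bar R :=
  (\sum_(0 <= l <oo) ((16 ^+ l) ^+ q * 2 ^+ l * \1_(layer l) y)%:E)%E.

Lemma measurable_layer l : measurable (layer l).
Proof.
rewrite -[layer l]setTI; have := mphi measurableT.
by move=> /(_ `]-oo, (16 / 16 ^+ l)[%classic (measurable_itv _)); rewrite preimage_itvNyo.
Qed.

Let term_ge0 l y : (0 <= ((16 ^+ l) ^+ q * 2 ^+ l * \1_(layer l) y : R)%:E)%E.
Proof. by rewrite lee_fin !mulr_ge0 ?exprn_ge0. Qed.

Let measurable_term l :
  measurable_fun setT (fun y => ((16 ^+ l) ^+ q * 2 ^+ l * \1_(layer l) y : R)%:E).
Proof.
apply/measurable_EFinP; apply: measurable_funM => //.
exact/measurable_indic/measurable_layer.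
Qed.

Lemma measurable_layer_weight : measurable_fun setT layer_weight.
Proof. exact: (@ge0_emeasurable_sum _ _ _ _ _ xpredT). Qed.

Lemma layer_weight_ge0 y : (0 <= layer_weight y)%E.
Proof. exact: nneseries_ge0. Qed.

(** The term of index l integrates to at most 16^(l q) 2^l C (16 / 16^l)^q (4 / 4^l) = 4 C 16^q /
    2^l, and this geometric series has sum 8 C 16^q. *)
Lemma integral_layer_weight (mu : {measure set S -> \bar R}) (C : R) : 0 <= C ->
  (forall rho : R, 0 < rho ->
    (mu [set y | (phi y < rho)%R] <= (C * rho ^+ q * Num.sqrt rho)%:E)%E) ->
  (\int[mu]_y layer_weight y <= (C * 16 ^+ q * 8)%:E)%E.
Proof.
move=> C0 H; rewrite integral_nneseries//.
apply: le_trans (epsilon_trick0 xpredT _); last first.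
  by rewrite !mulr_ge0 ?exprn_ge0.
apply: lee_nneseries => [l _ _|l _]; first exact: integral_ge0.
under eq_integral do rewrite EFinM.
have m1 : measurable_fun setT (fun y => (\1_(layer l) y : R)%:E).
  exact/measurable_EFinP/measurable_indic/measurable_layer.
have c0 : 0 <= (16 ^+ l) ^+ q * 2 ^+ l :> R by rewrite mulr_ge0 ?exprn_ge0.
rewrite ge0_integralZl_EFin//.
rewrite integral_indic//; last exact: measurable_layer.
rewrite setIT; have rho0 : (0 : R) < 16 / 16 ^+ l by rewrite divr_gt0 ?exprn_gt0.
rewrite (le_trans (lee_wpmul2l _ (H _ rho0)))//.
have -> : Num.sqrt (16 / 16 ^+ l) = 4 / 4 ^+ l :> R.
  rewrite (_ : 16 / 16 ^+ l = (4 / 4 ^+ l) ^+ 2).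
    by rewrite sqrtr_sqr ger0_norm// divr_ge0 ?exprn_ge0.
  by rewrite expr_div_n -exprM mulnC exprM -!natrX.
rewrite -EFinM lee_fin natrX exprS.
rewrite (_ : 4 ^+ l = 2 ^+ l * 2 ^+ l); last by rewrite -exprMn -natrM.
rewrite expr_div_n.
have t0 : (2 : R) ^+ l != 0 by rewrite expf_neq0.
have t1 : ((16 : R) ^+ l) ^+ q != 0 by rewrite !expf_neq0.
rewrite [leLHS](_ : _ = C * 16 ^+ q * 8 / (2 * 2 ^+ l))//.
by field; rewrite t0 t1.
Qed.

Let term_le l y :
  ((((16 ^+ l) ^+ q * 2 ^+ l * \1_(layer l) y : R)%:E) <= layer_weight y)%E.
Proof.
apply: le_trans (nneseries_lim_ge l.+1 _) => //.
by rewrite big_nat_recr//= leeDr// sume_ge0.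
Qed.

Lemma singular_weight_le_layer y : 0 < phi y < 16 ->
  ((singular_weight q (phi y))%:E <= layer_weight y)%E.
Proof.
move=> /andP[y0 y16].
(* The least l with 16^(-l) <= phi(y); minimality gives the upper bound, except at l = 0, where it
   is the assumption phi(y) < 16. *)
have [l ly] : exists l, (16 ^+ l)^-1 <= phi y < 16 / 16 ^+ l.
  have ex : exists l, (16 ^+ l)^-1 <= phi y.
    have [k] := ltr_add_invr y0; rewrite add0r => ky; exists k.
    rewrite (le_trans _ (ltW ky))// lef_pV2 ?posrE ?exprn_gt0//.
    by rewrite -natrX ler_nat ltn_expl.
  exists (ex_minn ex); case: ex_minnP => l -> lmin /=.
  case: l lmin => [|l] lmin; first by rewrite expr0 divr1.
  rewrite ltNge; apply/negP => H.
  suff /lmin : (16 ^+ l)^-1 <= phi y by rewrite ltnn.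
  by rewrite (le_trans _ H)// exprS invfM mulrA divff ?mul1r.
apply: le_trans (term_le l y); have /andP[l1 l2] := ly.
rewrite indicE mem_set//= mulr1 lee_fin /singular_weight invfM ler_pM//.
- by rewrite invr_ge0 exprn_ge0 ?ltW.
- by rewrite invr_ge0 root4_ge0.
- rewrite -[leRHS]invrK lef_pV2 ?posrE ?invr_gt0 ?exprn_gt0 ?exprn_gt0//.
  by rewrite -exprVn lerXn2r ?nnegrE ?invr_ge0 ?exprn_ge0// ltW.
- rewrite -[leRHS]invrK lef_pV2 ?posrE ?invr_gt0 ?exprn_gt0 ?root4_gt0//.
  rewrite (le_trans _ (le_root4 l1))// (_ : (16 ^+ l)^-1 = ((2 ^+ l)^-1 ^+ 2) ^+ 2).
    rewrite /root4 sqrtr_sqr ger0_norm ?sqr_ge0// sqrtr_sqr.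
    by rewrite ger0_norm ?lexx// invr_ge0 exprn_ge0.
  by rewrite -exprM exprVn -exprM (mulnC l) exprM -[2 ^+ _]natrX.
Qed.

(** Such a point lies in every layer, and every coefficient is at least 1. *)
Lemma layer_weight_pinfty y : phi y = 0 -> layer_weight y = +oo%E.
Proof.
move=> y0; apply/eqyP => A A0.
have [n An] : exists n : nat, A <= n%:R.
  by exists (Num.bound A); exact/ltW/archi_boundP/ltW.
apply: le_trans (nneseries_lim_ge n _) => //.
rewrite (@le_trans _ _ (\sum_(0 <= i < n) 1%:E)%E)//.
  by rewrite sumEFin lee_fin sumr_const_nat subn0.
apply: lee_sum => i _; rewrite lee_fin indicE mem_set ?mulr1; last first.
  by rewrite /layer/= y0 divr_gt0 ?exprn_gt0.
by rewrite mulr_ege1// ?exprn_ege1 ?exprn_ege1// ler1n.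
Qed.

End layer_weight.

(** * Differentiation under the integral *)

Lemma is_diff_near {R : realType} (V W : normedModType R) (f g df : V -> W)
    (x : V) : {near x, f =1 g} -> is_diff x f df -> is_diff x g df.
Proof.
move=> fg [dx <-]; have /diff_locallyP[cl /eqaddoP H] := dx.
have fgx : f x = g x := nbhs_singleton fg.
have H1 : g \o shift x = cst (g x) + 'd f x +o_ 0 id.
  apply/eqaddoP => e e0; have := H e e0; apply: filter_app.
  move: fg; rewrite (near_shift 0 x); apply: filterS => h /=.
  by rewrite !fctE /= subr0 fgx => ->.
have E := diff_unique cl H1.
by apply: DiffDef; [apply/diff_locallyP; rewrite E|].
Qed.

(** Openness makes the two differentials agree at every point of [U], which is what the recursion
    compares next. *)
Lemma differentiable_order_ext {R : realType} (V : normedModType R) j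
    (U : set V) (f g : V -> R) : open U -> (forall x, U x -> f x = g x) ->
  differentiable_order j U f -> differentiable_order j U g.
Proof.
move=> oU; elim: j f g => //= j IH f g fg [df Hf].
have D x : U x -> is_diff x g ('d f x).
  move=> Ux; apply: is_diff_near (differentiableP (df x Ux)).
  by apply: filterS (open_nbhs_nbhs (conj oU Ux)) => z Uz; exact: fg.
split => [x /D[]//|h]; apply: IH (Hf h) => x /D[_ ->//].
Qed.

Section integral_kernel.
Context {R : realType} {d : nat} {disp : measure_display}
  {S : measurableType disp}.
Variables (U : set 'rV[R]_d) (r : 'rV[R]_d -> S -> R) (L : R).
Hypotheses (oU : open U) (L1 : 1 <= L)
  (rL : forall v v' y,
    r v y ^+ 2 <= 2 * r v' y ^+ 2 + 2 * (L * `|v - v'|) ^+ 2)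
  (r_ge0 : forall v y, 0 <= r v y)
  (r_le2 : forall v y, U v -> r v y <= 2)
  (mr : forall v, measurable_fun setT (r v)).
Variables (mu : {measure set S -> \bar R}) (q : nat) (B : R).
Hypotheses (B_ge0 : 0 <= B) (mu_le : forall v, U v ->
  (\int[mu]_y layer_weight q (r v) y <= B%:E)%E).

Local Notation W v := (layer_weight q (r v)).

Let r16 v y : U v -> 0 < r v y -> 0 < r v y < 16.
Proof. by move=> /(r_le2 y) rv ->/=; rewrite (le_lt_trans rv)// ltr_nat. Qed.

Lemma Rintegral_linform (c : 'I_d -> S -> R) h :
  (forall i, mu.-integrable setT (EFin \o c i)) ->
  mu.-integrable setT (EFin \o (fun y => linform (c^~ y) h)) /\
  \int[mu]_y linform (c^~ y) h = linform (fun i => \int[mu]_y c i y) h.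
Proof.
move=> Ic; rewrite /linform; elim: (index_enum _) => [|i s [IHi IHe]].
  split; first by under eq_fun do rewrite big_nil; exact: integrable0.
  by under eq_Rintegral do rewrite big_nil; rewrite big_nil /Rintegral integral0.
have Ih : mu.-integrable setT (EFin \o (fun y => h 0 i * c i y)).
  exact: (integrableZl measurableT _ (Ic i)).
split.
  apply: eq_integrable (integrableD measurableT Ih IHi) => // y _.
  by rewrite /= big_cons EFinD.
under eq_Rintegral do rewrite big_cons.
by rewrite RintegralD// big_cons RintegralZl// IHe.
Qed.

(** Since r <= 2, passing from the exponent m to the larger q costs at most 2^(q - m). Where r = 0
    the right-hand side is +oo. *)
Lemma singular_weight_dom m v y : (m <= q)%N -> U v -> 0 <= r v y ->
  ((singular_weight m (r v y))%:E <= (2 ^+ q)%:E * W v y)%E.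
Proof.
move=> mq Uv; rewrite le_eqVlt => /predU1P[r0|ry].
  by rewrite layer_weight_pinfty// gt0_muley ?leey// lte_fin exprn_gt0.
apply: le_trans (lee_wpmul2l _ (singular_weight_le_layer _ (r16 Uv ry))).
have x0 : 0 < r v y ^+ q * root4 (r v y) by rewrite mulr_gt0 ?exprn_gt0 ?root4_gt0.
rewrite -EFinM lee_fin /singular_weight ler_pdivlMr// mulrC.
rewrite ler_pdivrMr ?mulr_gt0 ?exprn_gt0 ?root4_gt0// mulrA ler_wpM2r ?root4_ge0//.
rewrite -(subnKC mq) exprD mulrC ler_wpM2r ?exprn_ge0//.
rewrite (le_trans (_ : _ <= 2 ^+ (q - m)))//.
  by rewrite lerXn2r ?nnegrE// r_le2.
by rewrite subnKC// ler_weXn2l ?ler1n// leq_subr.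
by rewrite lee_fin exprn_ge0.
Qed.

Lemma kernel_dom s n e k : - q%:Z <= e -> kernel U r s n e k ->
  exists C, 0 < C /\ forall v y, U v -> (`|k v y|%:E <= C%:E * W v y)%E.
Proof.
move=> qe /kernel_base[_ [C bC] _].
have [a ea] : exists a : nat, e = a%:Z - q%:Z.
  exists (absz (e + q%:Z)); rewrite gez0_abs ?addrK//.
  by rewrite -lerBlDr sub0r.
(* r^a <= 2^a and r^(1/4) <= 2. The added 1 makes the constant positive, so that its product with
   +oo is +oo on r = 0, where nothing is known of [k]. *)
exists (`|C| * (2 ^+ a * 2) + 1); split => [|v y Uv].
  by rewrite ltr_wpDl// mulr_ge0// mulr_ge0// exprn_ge0.
have := r_ge0 v y; rewrite le_eqVlt => /predU1P[r0|ry].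
  by rewrite layer_weight_pinfty// gt0_muley ?leey// lte_fin ltr_wpDl//
    mulr_ge0// mulr_ge0// exprn_ge0.
apply: le_trans (lee_wpmul2l _ (singular_weight_le_layer _ (r16 Uv ry))).
have wq := singular_weight_ge0 q (r_ge0 v y).
rewrite -EFinM lee_fin (le_trans (bC v y Uv ry))// ea expfzDr ?gt_eqF//.
rewrite expz_weight// -[_ ^ _]/(_ ^+ _) [leLHS]mulrA [leLHS]mulrA ler_wpM2r//.
rewrite ler_wpDr// -mulrA (le_trans (_ : _ <= `|C| * (r v y ^+ a * root4 (r v y))))//.
  by rewrite ler_wpM2r ?ler_norm// mulr_ge0 ?exprn_ge0 ?root4_ge0.
rewrite ler_wpM2l// ler_pM ?exprn_ge0 ?root4_ge0//.
  by rewrite lerXn2r ?nnegrE// r_le2.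
rewrite -(@ler_pXn2r _ 4)// ?nnegrE ?root4_ge0// root4K//.
by rewrite (le_trans (r_le2 y Uv))// -natrX ler_nat.
by rewrite lee_fin addr_ge0// mulr_ge0// mulr_ge0// exprn_ge0.
Qed.

Lemma kernel_integrable s n e k v : - q%:Z <= e -> kernel U r s n e k -> U v ->
  mu.-integrable setT (EFin \o k v).
Proof.
move=> qe K Uv; have [C [C0 kC]] := kernel_dom qe K.
have [mk _ _] := kernel_base K.
apply/integrableP; split; first exact/measurable_EFinP.
have mW := measurable_layer_weight q (mr v).
apply: (@le_lt_trans _ _ (\int[mu]_y (C%:E * W v y))%E).
  apply: ge0_le_integral => //=.
  - exact/measurableT_comp/measurableT_comp/mk.
  - exact/emeasurable_funM.
  - by move=> y _; exact: kC.
rewrite ge0_integralZl_EFin//.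
- by rewrite (le_lt_trans (lee_wpmul2l _ (mu_le Uv)))// ?ltry// lee_fin ltW.
- by move=> y _; exact: layer_weight_ge0.
- exact: ltW.
Qed.

(** Integrating the Taylor estimate bounds the remainder by a multiple of |h|^(5/4), because the
    weights at v and at v + h both have integral at most [B]. *)
Lemma is_diff_integral_kernel n m k Dk v : (m <= q)%N -> U v ->
  kernel U r 1 n.+1 (1 - m%:Z) k ->
  (forall i, kernel U r 1 n.+1 (- m%:Z) (Dk i)) ->
  (forall v y, U v -> 0 < r v y ->
             is_diff v (k^~ y) (linform (fun i => Dk i v y))) ->
  is_diff v (fun v => \int[mu]_y k v y) (linform (fun i => \int[mu]_y Dk i v y)).
Proof.
move=> mq Uv K kD dk.
have Ik u : U u -> mu.-integrable setT (EFin \o k u).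
  apply: kernel_integrable K; rewrite addrC -lerBlDr -opprD lerN2.
  by rewrite -PoszD lez_nat addn1 leqW.
have ID i u : U u -> mu.-integrable setT (EFin \o Dk i u).
  by apply: kernel_integrable (kD i); rewrite lerN2 lez_nat.
have [C [C0 kC]] := kernel_taylor L1 rL r_ge0
  (let: And3 _ b _ := kernel_base K in b) kD dk.
apply: is_diff_of_estimate; first exact: is_diff_linform.
move=> e e0.
have /nbhs_ballP[dl /= dl0 dlU] : nbhs v U by exact: open_nbhs_nbhs.
(* The final bound is at most A |h|^(1/4) |h|, hence at most e |h| as soon as |h| < (e / A)^4. *)
pose A := (C + 1) * 2 ^+ q * (2 * B) + 1.
have A0 : 0 < A.
  by rewrite ltr_wpDl// !mulr_ge0 ?exprn_ge0 ?addr_ge0.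
apply/nbhs_ballP; exists (Num.min dl ((e / A) ^+ 4)).
  by rewrite /= lt_min dl0 exprn_gt0// divr_gt0.
move=> h; rewrite -ball_normE /ball_/= sub0r normrN lt_min => /andP[hdl hA].
(* A nonzero [h] makes the constant [c] below positive, as needed where the weight is infinite. *)
have [->|h0] := eqVneq h 0.
  rewrite add0r subrr sub0r normrN normr0 mulr0 /linform big1 ?normr0// => i _.
  by rewrite mxE mul0r.
rewrite [h + v]addrC; have a0 : 0 < `|h| by rewrite normr_gt0.
have Uvh (t : R) : 0 <= t <= 1 -> U (v + t *: h).
  move=> /andP[t0 t1]; apply: dlU; rewrite -ball_normE /ball_/=.
  rewrite opprD addrA subrr sub0r normrN normrZ ger0_norm//.
  by rewrite (le_lt_trans _ hdl)// ler_piMl.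
have Uh : U (v + h) by have := Uvh 1; rewrite scale1r lexx ler01; exact.
have [IDh <-] := Rintegral_linform h (fun i => ID i v Uv).
have Ikk : mu.-integrable setT (EFin \o (fun y => k (v + h) y - k v y)).
  exact: (integrableB measurableT (Ik _ Uh) (Ik _ Uv)).
rewrite -(RintegralB measurableT (Ik _ Uh) (Ik _ Uv)).
rewrite -(RintegralB measurableT Ikk IDh).
set F := (fun y => _).
have IF : mu.-integrable setT (EFin \o F).
  exact: (integrableB measurableT Ikk IDh).
have mF : measurable_fun setT F by exact/measurable_EFinP/(measurable_int mu).
rewrite (le_trans (le_normr_Rintegral _ _))// -lee_fin /Rintegral fineK; last first.
  exact/integrable_fin_num/(integrable_norm IF).
pose c := (C + 1) * (`|h| * root4 `|h|) * 2 ^+ q.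
have c0 : 0 < c.
  by rewrite !mulr_gt0 ?exprn_gt0 ?root4_gt0// ltr_wpDl.
have mW := measurable_layer_weight q (mr _).
apply: (@le_trans _ _ (\int[mu]_y (c%:E * (W v y + W (v + h) y)))%E).
  apply: ge0_le_integral => //=.
  - exact/measurable_EFinP/measurableT_comp.
  - by apply: emeasurable_funM => //; exact: emeasurable_funD.
  move=> y _.
  have W0 u : (0 <= W u y)%E by exact: layer_weight_ge0.
  (* Points of the singular set of v or of v + h cost nothing: the majorant is +oo there. *)
  have := r_ge0 v y; rewrite le_eqVlt => /predU1P[r0|ry].
    by rewrite (layer_weight_pinfty _ (esym r0)) addye ?gt0_muley ?leey// gt_eqF//
      (lt_le_trans _ (W0 _)).
  have := r_ge0 (v + h) y; rewrite le_eqVlt => /predU1P[r0|rhy].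
    by rewrite (layer_weight_pinfty _ (esym r0)) addey ?gt0_muley ?leey// gt_eqF//
      (lt_le_trans _ (W0 _)).
  apply: (@le_trans _ _ (((C + 1) * (`|h| * root4 `|h|))%:E *
    ((singular_weight m (r v y))%:E + (singular_weight m (r (v + h) y))%:E))%E).
    rewrite -EFinD -EFinM lee_fin (le_trans (kC _ _ _ Uvh ry rhy))//.
    rewrite ler_wpM2r ?addr_ge0 ?singular_weight_ge0//.
    by rewrite ler_wpM2r ?lerDl// mulr_ge0 ?root4_ge0.
  rewrite /c (EFinM _ (2 ^+ q)) -muleA lee_wpmul2l//.
    by rewrite lee_fin !mulr_ge0 ?root4_ge0// addr_ge0.
  by rewrite ge0_muleDr// leeD// singular_weight_dom.
rewrite ge0_integralZl_EFin//; last 3 first.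
- by move=> y _; rewrite adde_ge0// layer_weight_ge0.
- exact: emeasurable_funD.
- exact: ltW.
rewrite ge0_integralD//; [|by move=> y _; exact: layer_weight_ge0..].
rewrite (le_trans (lee_wpmul2l _ (leeD (mu_le Uv) (mu_le Uh))))//.
  by rewrite lee_fin ltW.
rewrite -EFinD -EFinM lee_fin.
rewrite (_ : c * (B + B) = (C + 1) * 2 ^+ q * (2 * B) * root4 `|h| * `|h|); last first.
  by rewrite /c; ring.
rewrite ler_wpM2r// (le_trans (_ : _ <= A * root4 `|h|))//.
  by rewrite ler_wpM2r ?root4_ge0// lerDl.
rewrite mulrC -ler_pdivlMr//.
rewrite -(@ler_pXn2r _ 4)// ?nnegrE ?root4_ge0// ?divr_ge0 ?(ltW e0) ?(ltW A0)//.
by rewrite root4K// ltW.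


Qed.


(** Differentiating trades one unit of j for one of m, so m + j is preserved. The kernel has one
    derivative more than the order obtained, since the Taylor estimate consumes second
    derivatives. *)
Lemma differentiable_order_integral_kernel j m k : (m + j <= q.+1)%N ->
  kernel U r 1 j.+1 (1 - m%:Z) k ->
  differentiable_order j U (fun v => \int[mu]_y k v y).
Proof.
elim: j m k => [//|j IH] m k mj K.
have mq : (m <= q)%N by rewrite -ltnS (leq_trans _ mj)// addnS ltnS leq_addr.
have [_ _ [Dk [kD dk]]] := K.
have e1 : 1 - m%:Z - 1 = - m%:Z by rewrite addrAC subrr sub0r.
have kD' i : kernel U r 1 j.+1 (- m%:Z) (Dk i) by rewrite -e1; exact: kD.
have D v (Uv : U v) := is_diff_integral_kernel mq Uv (kernelW K) kD' dk.
split => [v Uv|h]; first by case: (D v Uv).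
pose k1 v y := linform (fun i => Dk i v y) h.
have k1D : kernel U r 1 j.+1 (1 - m.+1%:Z) k1.
  rewrite (_ : 1 - m.+1%:Z = - m%:Z); last by rewrite -addn1 PoszD; ring.
  by apply: kernel_sum => i; exact: kernelZ.
have mj' : (m.+1 + j <= q.+1)%N by rewrite addSnnS.
apply: (differentiable_order_ext oU) (IH _ _ mj' k1D) => v Uv.
have [_ ->] := D v Uv; apply: (Rintegral_linform _ _).2 => i.
by apply: kernel_integrable (kD' i) Uv; rewrite lerN2 lez_nat.
Qed.

End integral_kernel.

(** * The function acos^2 / 2 up to t = 1 *)

Section power_series_radius2.
Context {R : realType}.
Implicit Types (c : R^nat) (K z : R).

(** Radius of convergence at least 2, stated through Cauchy's estimates. *)
Definition geom_bounded c :=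
  forall K, 0 < K < 2 -> exists C, forall n, `|c n| * K ^+ n <= C.

(** Take K' strictly between K and 2 and p = K / K'. Then (n + 1) p^n is bounded, because (n + 1)
    p^n (1 - p) <= (1 + p + ... + p^n) (1 - p) <= 1. *)
Lemma geom_bounded_diffs c : geom_bounded c -> geom_bounded (pseries_diffs c).
Proof.
move=> gc K /andP[K0 K2].
pose K' := (K + 2) / 2.
have KK' : K < K' by rewrite /K'; lra.
have K'2 : 0 < K' < 2 by apply/andP; split; rewrite /K'; lra.
have K'0 : 0 < K' by case/andP: K'2.
have [C bC] := gc _ K'2.
have C0 : 0 <= C by apply: le_trans (bC 0%N); rewrite mulr_ge0 ?exprn_ge0// ltW.
pose p := K / K'.
have p0 : 0 <= p by rewrite divr_ge0// ltW.
have p1 : p < 1 by rewrite ltr_pdivrMr// mul1r.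
have p1' : 0 < 1 - p by rewrite subr_gt0.
have np n : n.+1%:R * p ^+ n <= (1 - p)^-1.
  rewrite -[leRHS]mul1r ler_pdivlMr//.
  apply: (@le_trans _ _ ((\sum_(i < n.+1) p ^+ i) * (1 - p))).
    rewrite ler_wpM2r ?(ltW p1')// -[n.+1 in leLHS]card_ord mulr_natl -sumr_const.
    by apply: ler_sum => i _; rewrite ler_wiXn2l ?(ltW p1)// -ltnS.
  have := subrX1 p n.+1; rewrite -opprB -[p - 1]opprB mulNr => /oppr_inj.
  by rewrite mulrC => <-; rewrite lerBlDr lerDl exprn_ge0.
exists (C / K' * (1 - p)^-1) => n.
rewrite /pseries_diffs normrM ger0_norm//.
rewrite (_ : _ * _ * _ = (n.+1%:R * p ^+ n) * (`|c n.+1| * K' ^+ n.+1) / K').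
  rewrite -mulrA [leRHS](_ : _ = (1 - p)^-1 * (C / K')); last by ring.
  have K'i : 0 <= K'^-1 by rewrite invr_ge0 (ltW K'0).
  by rewrite ler_pM// ?mulr_ge0 ?exprn_ge0 ?(ltW K'0)// ler_wpM2r.
rewrite /p expr_div_n exprS; field.
by rewrite expf_neq0 gt_eqF.
Qed.

Lemma geom_bounded_cvg c z : geom_bounded c -> `|z| < 2 -> cvgn (pseries c z).
Proof.
move=> gc z2.
pose K := (`|z| + 2) / 2.
have z0 := normr_ge0 z.
have zK : `|z| < K by rewrite /K; lra.
have K2 : 0 < K < 2 by apply/andP; split; rewrite /K; lra.
have K0 : 0 < K by case/andP: K2.
have [C bC] := gc _ K2.
apply: normed_cvg.
have C_ge0 : 0 <= C.
  by apply: le_trans (bC 0%N); rewrite mulr_ge0 ?exprn_ge0// ltW.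
have C0 n : 0 <= geometric C (`|z| / K) n.
  by rewrite /= mulr_ge0 ?exprn_ge0 ?divr_ge0 ?(ltW K0).
apply: (series_le_cvg _ C0) => [n|n|] /=; first exact: normr_ge0.
  rewrite normrM normrX expr_div_n mulrA ler_pdivlMr ?exprn_gt0//.
  by rewrite mulrAC ler_wpM2r ?exprn_ge0.
apply: is_cvg_geometric_series.
by rewrite ger0_norm ?divr_ge0 ?(ltW K0)// ltr_pdivrMr// mul1r.
Qed.

Definition psum c z := limn (pseries c z).

Lemma is_derive_psum c z : geom_bounded c -> `|z| < 2 ->
  is_derive z 1 (psum c) (psum (pseries_diffs c) z).
Proof.
move=> gc z2; pose K := (`|z| + 2) / 2.
have z0 := normr_ge0 z.
have K0 : 0 <= K by rewrite /K; lra.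
have K2 : `|K| < 2 by rewrite ger0_norm// /K; lra.
have zK : `|z| < `|K| by rewrite (ger0_norm K0) /K; lra.
apply: (@pseries_snd_diffs _ c K) zK.
- exact: geom_bounded_cvg.
- exact/geom_bounded_cvg/K2/geom_bounded_diffs.
- exact/geom_bounded_cvg/K2/geom_bounded_diffs/geom_bounded_diffs.
Qed.

(** The numbers n! / (1 3 5 ... (2n + 1)), coefficients of acos t / sqrt (1 - t^2) in powers of 1 -
    t. *)
Fixpoint acos_coef (n : nat) : R :=
  if n is n'.+1 then acos_coef n' * (n'.+1%:R / (n'.*2.+3)%:R) else 1.

Lemma acos_coef_ge0 n : 0 <= acos_coef n.
Proof. by elim: n => //= n IH; rewrite mulr_ge0// divr_ge0. Qed.

Lemma acos_coef_le n : acos_coef n <= 2^-1 ^+ n.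
Proof.
elim: n => //= n IH; rewrite exprSr ler_pM ?acos_coef_ge0 ?divr_ge0//.
rewrite ler_pdivrMr// mulrC -[leRHS]/(_ / 2) ler_pdivlMr// -natrM ler_nat.
by rewrite muln2 doubleS.
Qed.

(* Coefficients, at t = 1, of the antiderivative of -acos t / sqrt(1 - t^2) that
   vanishes there. *)
Definition acos2_coef (n : nat) : R :=
  if n is n'.+1 then acos_coef n' / n%:R else 0.

Lemma acos2_coef_diffs : pseries_diffs acos2_coef = acos_coef.
Proof.
by apply/funext => n; rewrite /pseries_diffs /= mulrC divfK// pnatr_eq0.
Qed.

Lemma geom_bounded_acos2_coef : geom_bounded acos2_coef.
Proof.
move=> K /andP[K0 K2]; exists 2 => -[|n]; first by rewrite normr0 mul0r.
rewrite ger0_norm ?divr_ge0 ?acos_coef_ge0// exprS.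
rewrite (le_trans (_ : _ <= acos_coef n * (K * K ^+ n)))//.
  rewrite ler_wpM2r ?mulr_ge0 ?exprn_ge0 ?(ltW K0)//.
  by rewrite ler_piMr ?acos_coef_ge0// invf_le1// ler1n.
rewrite mulrCA -[leRHS]mulr1 ler_pM ?mulr_ge0 ?exprn_ge0 ?acos_coef_ge0 ?(ltW K0) ?(ltW K2)//.
rewrite (le_trans (ler_wpM2r _ (acos_coef_le n))) ?exprn_ge0 ?(ltW K0)//.
by rewrite -exprMn exprn_ile1 ?mulr_ge0 ?invr_ge0 ?(ltW K0)//; lra.
Qed.

Definition acos2_diffs m := iter m (@pseries_diffs R) acos2_coef.

Lemma geom_bounded_acos2 m : geom_bounded (acos2_diffs m).
Proof.
elim: m => [|m IH]; first exact: geom_bounded_acos2_coef.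
exact: geom_bounded_diffs.
Qed.

(** The recurrence of the coefficients, summed. The lengths are chosen so that every product stops
    at degree N + 1, which makes the identity exact, without remainder. *)
Lemma acos2_ode_partial N z :
  2 * z * pseries (acos2_diffs 2) z N.+1 + pseries (acos2_diffs 1) z N.+2 =
  1 + z ^+ 2 * pseries (acos2_diffs 2) z N + z * pseries (acos2_diffs 1) z N.+1.
Proof.
rewrite /acos2_diffs/= acos2_coef_diffs.
have S (u : R^nat) n : pseries u z n.+1 = pseries u z n + u n * z ^+ n.
  exact: seriesSr.
elim: N => [|N IH].
  rewrite !S /pseries !seriesEnat/= !big_geq//= /pseries_diffs/=.
  by rewrite double0 expr0 expr1; field.
have bS n : acos_coef n.+1 = acos_coef n * (n.+1%:R / (n.*2.+3)%:R) by [].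
rewrite (S _ N.+1) (S _ N.+2) mulrDr addrACA IH.
rewrite (S (pseries_diffs acos_coef) N) [in RHS](S acos_coef N.+1).
rewrite /pseries_diffs !bS doubleS -addnn !exprS -!natr1 natrD.
have n0 : (0 : R) <= N%:R by [].
by field; repeat (apply/andP; split); apply: lt0r_neq0; lra.
Qed.

Lemma acos2_ode z : `|z| < 2 ->
  z * (2 - z) * psum (acos2_diffs 2) z = 1 - (1 - z) * psum (acos2_diffs 1) z.
Proof.
move=> z2.
have c1 : pseries (acos2_diffs 1) z @ \oo --> psum (acos2_diffs 1) z.
  exact: geom_bounded_cvg (geom_bounded_acos2 1) z2.
have c2 : pseries (acos2_diffs 2) z @ \oo --> psum (acos2_diffs 2) z.
  exact: geom_bounded_cvg (geom_bounded_acos2 2) z2.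
have sh u (l : R) : u @ \oo --> l -> (fun n => u n.+1) @ \oo --> l.
  by rewrite cvg_shiftS.
have cL : (fun n => 2 * z * pseries (acos2_diffs 2) z n.+1 +
    pseries (acos2_diffs 1) z n.+2) @ \oo -->
    2 * z * psum (acos2_diffs 2) z + psum (acos2_diffs 1) z.
  by apply: cvgD; [apply: cvgM; [exact: cvg_cst|exact: sh]|exact: (sh _ _ (sh _ _ c1))].
have cR : (fun n => 1 + z ^+ 2 * pseries (acos2_diffs 2) z n +
    z * pseries (acos2_diffs 1) z n.+1) @ \oo -->
    1 + z ^+ 2 * psum (acos2_diffs 2) z + z * psum (acos2_diffs 1) z.
  apply: cvgD; last by apply: cvgM; [exact: cvg_cst|exact: sh].
  by apply: cvgD; [exact: cvg_cst|apply: cvgM; [exact: cvg_cst|]].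
have E := cL; rewrite (funext (fun N => acos2_ode_partial N z)) in E.
have {}E := cvg_unique (@norm_hausdorff _ R) E cR.
set P1 := psum (acos2_diffs 1) z in E *; set P2 := psum (acos2_diffs 2) z in E *.
apply/eqP; rewrite -subr_eq0.
rewrite [X in X == 0](_ : _ = 2 * z * P2 + P1 - (1 + z ^+ 2 * P2 + z * P1)).
  by rewrite E subrr.
by ring.
Qed.

End power_series_radius2.

(** * Derivatives of acos^2 / 2 and their differential equations *)

Section acos2.
Context {R : realType}.
Implicit Types (t x : R) (m : nat).

(** The m-th derivative in t of the expansion at t = 1; the sign comes from the inner function 1 -
    t. *)
Definition acos2_series m t : R := (-1) ^+ m * psum (acos2_diffs m) (1 - t).

Let radius t : -1 < t < 3 -> `|1 - t| < 2.
Proof. by move=> /andP[t0 t1]; rewrite ltr_norml; apply/andP; split; lra. Qed.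

Lemma is_derive_acos2_series m t : -1 < t < 3 ->
  is_derive t 1 (acos2_series m) (acos2_series m.+1 t).
Proof.
move=> /radius t2.
have D1 : is_derive t 1 (fun x : R => 1 - x) (-1).
  by apply: is_derive_eq; ring.
have := @is_derive1_comp _ (psum (acos2_diffs m)) (fun x => 1 - x) t _ _
    (is_derive_psum (geom_bounded_acos2 m) t2) D1.
move=> D; have {}D := @is_deriveZ _ _ _ _ ((-1) ^+ m) _ _ _ D.
apply: (is_derive_eq D).
by rewrite /acos2_series exprS /= /GRing.scale/=; ring.
Qed.

(** For m = 0 it is the equation of acos t / sqrt (1 - t^2). The induction differentiates the
    previous identity, which holds on a whole neighborhood of t. *)
Lemma acos2_series_ode m t : -1 < t < 3 ->
  (1 - t ^+ 2) * acos2_series m.+2 t =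
  m.*2.+1%:R * t * acos2_series m.+1 t + m%:R ^+ 2 * acos2_series m t +
  (m == 0)%:R.
Proof.
elim: m t => [|m IH] t t3.
  have := acos2_ode (radius t3); rewrite /acos2_series.
  set P1 := psum _ _; set P2 := psum _ _; rewrite eqxx expr0n /= => E.
  rewrite double0 expr1 mul0r addr0 sqrrN expr1n !mul1r.
  rewrite [LHS](_ : _ = (1 - t) * (2 - (1 - t)) * P1); last by ring.
  rewrite E; ring.
have D k := is_derive_acos2_series k t3.
have D1 : is_derive t 1 (fun x => (1 - x ^+ 2) * acos2_series m.+2 x)
    (- (2 * t) * acos2_series m.+2 t + (1 - t ^+ 2) * acos2_series m.+3 t).
  have D2 : is_derive t 1 (fun x : R => 1 - x ^+ 2) (- (2 * t)).
    by apply: is_derive_eq; rewrite /GRing.scale/=; ring.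
  have := is_deriveM D2 (D m.+2) => D3.
  by apply: is_derive_eq; rewrite /GRing.scale/=; ring.
have D2 : is_derive t 1 (fun x => m.*2.+1%:R * x * acos2_series m.+1 x +
      m%:R ^+ 2 * acos2_series m x + (m == 0)%:R)
    (m.*2.+1%:R * (acos2_series m.+1 t + t * acos2_series m.+2 t) +
      m%:R ^+ 2 * acos2_series m.+1 t).
  have D3 : is_derive t 1 (fun x : R => m.*2.+1%:R * x) m.*2.+1%:R.
    by apply: is_derive_eq; rewrite /GRing.scale/= mulr1.
  have D4 := is_deriveM D3 (D m.+1).
  have D5 := is_deriveD (is_deriveD D4 (@is_deriveZ _ _ _ _ (m%:R ^+ 2) _ _ _ (D m)))
    (is_derive_cst ((m == 0)%:R : R) t 1).
  by apply: is_derive_eq; rewrite /GRing.scale/=; ring.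
have nt : \forall x \near t, -1 < x < 3.
  by have := near_in_itvoo; move=> /(_ R (-1) 3 t); rewrite in_itv/=; exact.
have E := @near_eq_derive _ _ _ _ _ t 1 (filterS (fun x => IH x) nt).
move: E; rewrite (@derive_val _ _ _ _ _ _ _ D1) (@derive_val _ _ _ _ _ _ _ D2) => E.
rewrite addr0 [LHS](_ : _ = (- (2 * t) * acos2_series m.+2 t +
  (1 - t ^+ 2) * acos2_series m.+3 t) + 2 * t * acos2_series m.+2 t); last by ring.
by rewrite E doubleS -addnn -!natr1 natrD; ring.
Qed.

Lemma constant_of_derive0 (h : R -> R) b : 0 <= b ->
  (forall x, 0 <= x <= b -> is_derive x 1 h 0) -> h b = h 0.
Proof.
move=> b0 dh; have [||c _] := @MVT_segment _ h (fun _ => 0) 0 b b0.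
- by move=> x; rewrite in_itv/= => /andP[x0 xb]; apply: dh; rewrite !ltW.
- apply: continuous_in_subspaceT => x; rewrite inE/= in_itv/= => xb.
  exact: is_derive1_continuous (dh x xb).
- by rewrite mul0r => /eqP; rewrite subr_eq0 => /eqP.
Qed.

Lemma psum0 (c : R^nat) : c 0%N = 0 -> psum c 0 = 0.
Proof.
move=> c0; rewrite /psum (_ : pseries c 0 = cst 0) ?lim_cst//.
apply/funext => n; rewrite /pseries seriesEnat/= big1// => -[_|i _].
  by rewrite c0 mul0r.
by rewrite expr0n mulr0.
Qed.

Lemma cos_range x : 0 <= x < pi -> -1 < cos x < 3.
Proof.
move=> /andP[x0 xpi]; apply/andP; split; last first.
  by rewrite (le_lt_trans (cos_le1 x))// ltr1n.
by rewrite -cospi ltr_cos// in_itv/= ?x0 ?lexx ?(ltW xpi)// pi_ge0.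
Qed.

(** The substitution t = cos x avoids differentiating acos at t = 1: by the equation with m = 0, sin
    y G_1(cos y) + y has zero derivative, and it vanishes at 0. *)
Lemma acos2_series1_cos x : 0 <= x < pi -> sin x * acos2_series 1 (cos x) = - x.
Proof.
move=> /andP[x0 xpi]; apply/eqP; rewrite -subr_eq0 opprK; apply/eqP.
pose h y := sin y * acos2_series 1 (cos y) + y.
suff dh y : 0 <= y <= x -> is_derive y 1 h 0.
  by rewrite -/(h x) (constant_of_derive0 x0 dh) /h sin0 mul0r addr0.
move=> /andP[y0 yx].
have ry : -1 < cos y < 3 by apply: cos_range; rewrite y0 (le_lt_trans yx).
have D1 := is_derive1_comp (is_derive_acos2_series 1 ry) (is_derive_cos y).
have D2 := is_deriveD (is_deriveM (is_derive_sin y) D1) (is_derive_id y 1).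
apply: is_derive_eq; rewrite /GRing.scale/=.
have := acos2_series_ode 0 ry; rewrite -sin2cos2 double0 => E.
rewrite [LHS](_ : _ = - (sin y ^+ 2 * acos2_series 2 (cos y)) +
  cos y * acos2_series 1 (cos y) + 1); last by ring.
by rewrite E eqxx expr0n/=; ring.
Qed.

Lemma acos2_seriesE t : -1 < t <= 1 -> acos2_series 0 t = acos t ^+ 2 / 2.
Proof.
move=> /andP[t0 t1]; have tI : t \in `[-1, 1] by rewrite in_itv/= t1 ltW.
have x0 : 0 <= acos t by apply: acos_ge0; rewrite t1 ltW.
have xpi : acos t < pi by apply: acos_ltpi; rewrite t0.
rewrite -{1}(acosK tI); apply/eqP; rewrite -subr_eq0; apply/eqP.
pose h y := acos2_series 0 (cos y) - y ^+ 2 / 2.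
suff dh y : 0 <= y <= acos t -> is_derive y 1 h 0.
  rewrite -/(h (acos t)) (constant_of_derive0 x0 dh) /h cos0 /acos2_series subrr.
  by rewrite psum0// mulr0 sub0r expr0n/= mul0r oppr0.
move=> /andP[y0 yx].
have yp : 0 <= y < pi by rewrite y0 (le_lt_trans yx).
have D1 := is_derive1_comp (is_derive_acos2_series 0 (cos_range yp)) (is_derive_cos y).
have D2 : is_derive y 1 (fun y : R => y ^+ 2 / 2) y.
  by apply: is_derive_eq; rewrite /GRing.scale/=; field.
have D3 := is_deriveB D1 D2; apply: is_derive_eq.
have := acos2_series1_cos yp; rewrite mulrC => E.
by rewrite mulrN E opprK subrr.
Qed.

End acos2.

(** * Growth of the derivatives at t = -1 *)

Section acos2_bounds.
Context {R : realType}.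
Implicit Types (t x r : R) (m : nat).
Local Notation G := (@acos2_series R).

Lemma acos2_series_bounded01 m :
  exists M, 0 <= M /\ forall t, 0 <= t <= 1 -> `|G m t| <= M.
Proof.
have cG : {within `[0, 1], continuous (fun t => `|G m t|)}.
  apply: continuous_in_subspaceT => t; rewrite inE/= in_itv/= => /andP[t0 t1].
  have t3 : -1 < t < 3 by apply/andP; split; lra.
  apply: continuous_comp; last exact: norm_continuous.
  exact: is_derive1_continuous (is_derive_acos2_series m t3).
have [c _ cmax] := EVT_max ler01 cG.
exists `|G m c|; split => // t t01; apply: cmax; by rewrite in_itv.
Qed.

(** The power (1 + t)^(m + 1/2), inverse to the expected growth of the derivative of order m + 1. *)
Definition acos2_weight m t : R := Num.sqrt (1 + t) * (1 + t) ^+ m.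

Lemma acos2_weight_ge0 m t : -1 < t -> 0 <= acos2_weight m t.
Proof. by move=> t0; rewrite mulr_ge0 ?sqrtr_ge0// exprn_ge0//; lra. Qed.

Lemma acos2_weightS m t : acos2_weight m.+1 t = (1 + t) * acos2_weight m t.
Proof. by rewrite /acos2_weight exprS mulrCA. Qed.

Lemma acos2_weight_le m t : -1 < t <= 1 -> acos2_weight m t <= 2 ^+ m.+1.
Proof.
move=> /andP[t0 t1]; rewrite exprS ler_pM ?sqrtr_ge0 ?exprn_ge0//; [lra| |].
  by rewrite -(@ler_pXn2r _ 2)// ?nnegrE ?sqrtr_ge0// sqr_sqrtr; lra.
by rewrite lerXn2r// ?nnegrE; lra.
Qed.

Lemma acos2_series_bound m : exists C, 0 <= C /\ forall t, -1 < t <= 1 ->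
  `|G m.+1 t| * acos2_weight m t <= C.
Proof.
(* On [0, 1] the derivatives are bounded by compactness, so only t < 0 is left. *)
have pos m1 : (exists C, forall t, -1 < t < 0 ->
    `|G m1.+1 t| * acos2_weight m1 t <= C) ->
  exists C, 0 <= C /\ forall t, -1 < t <= 1 ->
    `|G m1.+1 t| * acos2_weight m1 t <= C.
  move=> [C HC]; have [M [M0 HM]] := acos2_series_bounded01 m1.+1.
  exists (`|C| + M * 2 ^+ m1.+1); split.
    by rewrite addr_ge0// mulr_ge0// exprn_ge0.
  move=> t /andP[t0 t1]; have [tn|tp] := ltP t 0.
    rewrite (le_trans (HC t _)) ?t0// (le_trans (ler_norm C))// lerDl.
    by rewrite mulr_ge0// exprn_ge0.
  rewrite ler_wpDl// ler_pM ?acos2_weight_ge0//; first by rewrite HM// tp.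
  by rewrite acos2_weight_le// t0.
(* The second conjunct carries the lowest term of the differential equation; its factor m^2 disposes
   of m = 0, where the first conjunct says nothing of [G 0]. *)
suff [//] : (exists C, 0 <= C /\ forall t, -1 < t <= 1 ->
  `|G m.+1 t| * acos2_weight m t <= C) /\
  (exists C, 0 <= C /\ forall t, -1 < t <= 1 ->
  m%:R ^+ 2 * `|G m t| * acos2_weight m t <= C).
elim: m => [|m [[C1 [C1_ge0 H1]] [C2 [C2_ge0 H2]]]]; split.
(* With t = cos x one has sin x |G_1(t)| = x <= pi, and sqrt (1 + t) <= sin x because t < 0. *)
- apply: pos; exists pi => t /andP[t0 t1].
  have ht : 0 <= acos t < pi.
    by rewrite acos_ge0 ?acos_ltpi//; apply/andP; split; lra.
  have tI : -1 <= t <= 1 by apply/andP; split; lra.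
  have := acos2_series1_cos ht; rewrite acosK ?in_itv// sin_acos// => E.
  have := congr1 Num.norm E; rewrite normrN normrM (ger0_norm (sqrtr_ge0 _)).
  case/andP: ht => /ger0_norm -> /ltW hp E1; rewrite -E1 in hp.
  rewrite (le_trans _ hp)// mulrC /acos2_weight expr0 mulr1 ler_wpM2r//.
  by apply: ler_wsqrtr; rewrite expr2; nra.
- by exists 0; split => // t _; rewrite expr0n/= !mul0r.
- apply: pos; exists (m.*2.+1%:R * C1 + C2 + 1) => t /andP[t0 tn].
  have t3 : -1 < t < 3 by apply/andP; split; lra.
  have tI : -1 < t <= 1 by apply/andP; split; lra.
  have w0 := acos2_weight_ge0 m t0.
  have w1 : acos2_weight m t <= 1.
    rewrite mulr_ile1 ?sqrtr_ge0 ?exprn_ge0 ?exprn_ile1//; try lra.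
    by rewrite -(@ler_pXn2r _ 2)// ?nnegrE ?sqrtr_ge0// sqr_sqrtr; lra.
  rewrite acos2_weightS mulrA.
  (* For t < 0 the new factor 1 + t is at most 1 - t^2, which the differential equation exchanges
     for lower derivatives. *)
  apply: (@le_trans _ _ (`|G m.+2 t| * (1 - t ^+ 2) * acos2_weight m t)).
    by rewrite ler_wpM2r// ler_wpM2l//; nra.
  have u0 : 0 <= 1 - t ^+ 2 by nra.
  rewrite -[X in _ * X * _](ger0_norm u0) -normrM mulrC [G _ _ * _]mulrC.
  rewrite acos2_series_ode// mulrC.
  rewrite (le_trans (ler_wpM2r w0 (ler_normD _ _)))//.
  rewrite (le_trans (ler_wpM2r w0 (lerD (ler_normD _ _) (lexx _))))//.
  rewrite !mulrDl !lerD//.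
  + rewrite 2!normrM normr_nat -!mulrA ler_wpM2l//.
    rewrite (le_trans _ (H1 t tI))// ler_piMl ?(mulr_ge0 (normr_ge0 _) w0)//.
    by rewrite ler_norml; apply/andP; split; lra.
  + by rewrite normrM ger0_norm ?exprn_ge0// H2.
  + by rewrite normr_nat; case: (m == 0); rewrite ?mul1r// mul0r.
exists (m.+1%:R ^+ 2 * (C1 * 2)); split; first by rewrite !mulr_ge0// exprn_ge0.
move=> t /andP[t0 t1]; rewrite -mulrA ler_wpM2l ?exprn_ge0//.
rewrite acos2_weightS [_ * acos2_weight m t]mulrC mulrA.
have w0 := acos2_weight_ge0 m t0.
rewrite ler_pM ?(mulr_ge0 (normr_ge0 _) w0)//; [lra| |lra].
by rewrite H1// t0.
Qed.

(** With u = (pi - acos t) / 2 the difference is -u (pi + acos t), and 1 + t = 2 sin^2 u. As cos u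
    lies in [0, 1], the bound on G_1 there gives u = sin u |G_1(cos u)| <= M sin u. *)
Lemma acos2_antipode_bound : exists C, 0 <= C /\ forall t, -1 <= t <= 1 ->
  `|acos t ^+ 2 / 2 - pi ^+ 2 / 2| <= C * Num.sqrt (1 + t).
Proof.
have [M [M0 HM]] := acos2_series_bounded01 1.
have pi0 : 0 <= pi :> R := pi_ge0 R.
have pi20 : 0 <= 2 * pi :> R by exact: mulr_ge0 (ler0n _ 2) pi0.
exists (2 * pi * M); split => [|t tI]; first exact: mulr_ge0.
have a0 := acos_ge0 tI; have ap := acos_lepi tI.
pose u := (pi - acos t) / 2.
have u0 : 0 <= u by rewrite /u; lra.
have up : u <= pi / 2 by rewrite /u; lra.
have upi : 0 <= u < pi by rewrite u0/= (le_lt_trans up)//; have := pi_gt0 R; lra.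
have su : 0 <= sin u.
  by apply: sin_ge0_pi; case/andP: upi => -> /ltW ->.
have cu : 0 <= cos u <= 1.
  by rewrite cos_le1 andbT cos_ge0_pihalf// up andbT; lra.
have uM : u <= M * sin u.
  have := congr1 Num.norm (acos2_series1_cos upi).
  rewrite normrN normrM (ger0_norm u0) (ger0_norm su) => E; rewrite -{1}E.
  by rewrite mulrC ler_wpM2r// HM.
have tE : 1 + t = 2 * sin u ^+ 2.
  have <- : cos (acos t) = t by rewrite acosK// in_itv.
  rewrite (_ : acos t = pi - u *+ 2); last by rewrite /u mulr2n; lra.
  rewrite cosB cospi sinpi mul0r addr0 cos_mulr2n cos2sin2 mulr2n; ring.
have sut : sin u <= Num.sqrt (1 + t).
  rewrite -(@ler_pXn2r _ 2)// ?nnegrE ?sqrtr_ge0// sqr_sqrtr tE.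
    by rewrite ler_peMl ?sqr_ge0// ler1n.
  by rewrite mulr_ge0 ?sqr_ge0.
rewrite (_ : _ - _ = - (u * (pi + acos t))); last by rewrite /u; field.
rewrite normrN ger0_norm; last exact: mulr_ge0 u0 (addr_ge0 pi0 a0).
rewrite (le_trans (_ : _ <= u * (2 * pi)))//; first by rewrite ler_wpM2l//; lra.
by rewrite mulrC -[leRHS]mulrA ler_wpM2l// (le_trans uM)// ler_wpM2l.
Qed.

End acos2_bounds.

(** * The normalized functions on the whole line *)

Section acos2_part.
Context {R : realType}.
Implicit Types (t x r : R) (m : nat).
Local Notation G := (@acos2_series R).
Local Notation I := (`]-1, 3[%classic : set R).

(* Cut off to 0 outside the disk of convergence, so that it is measurable; the
   constant makes it vanish at t = -1 too, in the limit as well as by convention. *)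
Definition acos2_part m : R -> R :=
  (fun t => G m t - (m == 0)%:R * (pi ^+ 2 / 2)) \_ I.

Lemma acos2_partE m t : -1 < t < 3 ->
  acos2_part m t = G m t - (m == 0)%:R * (pi ^+ 2 / 2).
Proof. by move=> t3; rewrite /acos2_part patchE mem_set//= in_itv. Qed.

Let is_deriveG m t : -1 < t < 3 ->
  is_derive t 1 (fun t => G m t - (m == 0)%:R * (pi ^+ 2 / 2)) (G m.+1 t).
Proof.
move=> t3; have D := is_deriveB (is_derive_acos2_series m t3)
  (is_derive_cst ((m == 0)%:R * (pi ^+ 2 / 2) : R) t 1).
by apply: (is_derive_eq D); rewrite subr0.
Qed.

Lemma is_derive_acos2_part m t : -1 < t < 3 ->
  is_derive t 1 (acos2_part m) (acos2_part m.+1 t).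
Proof.
move=> t3; rewrite acos2_partE// mul0r subr0.
apply: near_eq_is_derive (is_deriveG m t3).
have := near_in_itvoo; move=> /(_ R (-1) 3 t); rewrite in_itv/= => /(_ t3).
by apply: filterS => x /= x3; rewrite acos2_partE.
Qed.

Lemma measurable_acos2_part m : measurable_fun setT (acos2_part m).
Proof.
apply/(measurable_restrictT _ _).1 => //.
apply: open_continuous_measurable_fun; first exact: interval_open.
move=> t; rewrite inE/= in_itv/= => t3.
exact: is_derive1_continuous (is_deriveG m t3).
Qed.

Lemma acos2_part0 t : -1 <= t <= 1 ->
  acos2_part 0 t = acos t ^+ 2 / 2 - pi ^+ 2 / 2.
Proof.
rewrite le_eqVlt => /andP[/predU1P[<- _|t0 t1]].
  by rewrite acosN1 subrr /acos2_part patchE memNset//= in_itv/= ltxx.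
have t3 : -1 < t < 3 by apply/andP; split; lra.
by rewrite acos2_partE// mul1r acos2_seriesE// t0.
Qed.

(** The relation between r and t makes r comparable with sqrt (1 + t), so the growth estimates at t
    = -1 become powers of r. *)
Lemma acos2_part_bound m : exists C, forall t r, -1 < t <= 1 -> 0 < r ->
  r ^+ 2 = 2 + 2 * t -> `|acos2_part m t| <= C * r ^ (1 - m.*2%:Z).
Proof.
have rs t r : -1 < t -> 0 < r -> r ^+ 2 = 2 + 2 * t ->
    Num.sqrt (1 + t) <= r <= 2 * Num.sqrt (1 + t).
  move=> t0 r0 rE; have s0 := sqrtr_ge0 (1 + t).
  have sE : Num.sqrt (1 + t) ^+ 2 = 1 + t by rewrite sqr_sqrtr; lra.
  apply/andP; split; rewrite -(@ler_pXn2r _ 2)// ?nnegrE ?mulr_ge0// ?(ltW r0)//.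
    by rewrite rE sE; lra.
  by rewrite exprMn rE sE; lra.
case: m => [|m].
  have [C [C0 HC]] := @acos2_antipode_bound R.
  exists C => t r /andP[t0 t1] r0 rE; rewrite subr0 expr1z.
  have tI : -1 <= t <= 1 by rewrite t1 ltW.
  rewrite acos2_part0// (le_trans (HC t tI))// ler_wpM2l//.
  by have /andP[] := rs t r t0 r0 rE.
have [C [C0 HC]] := @acos2_series_bound R m.
exists (C * 2 ^+ m.+1) => t r /andP[t0 t1] r0 rE.
have t3 : -1 < t < 3 by apply/andP; split; lra.
rewrite acos2_partE// mul0r subr0.
have tp : 0 < 1 + t by lra.
have w0 : 0 < acos2_weight m t by rewrite mulr_gt0 ?sqrtr_gt0 ?exprn_gt0.
have := HC t; rewrite t0 => /(_ t1); rewrite -ler_pdivlMr// => /le_trans; apply.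
rewrite -mulrA ler_wpM2l//.
rewrite (_ : 1 - m.+1.*2%:Z = - m.*2.+1%:Z); last first.
  by rewrite doubleS intS opprD addrA subrr sub0r.
rewrite -exprz_inv -[_ ^ _]/(_ ^+ _) exprVn ler_pdivlMr ?exprn_gt0//.
rewrite mulrC ler_pdivrMr// exprS -muln2 mulnC exprM rE.
rewrite (_ : 2 + 2 * t = 2 * (1 + t)); last by ring.
rewrite exprMn exprS /acos2_weight.
have /andP[_ r2] := rs t r t0 r0 rE.
rewrite [leRHS](_ : _ = (2 * Num.sqrt (1 + t)) * (2 ^+ m * (1 + t) ^+ m)); last by ring.
by rewrite ler_wpM2r// mulr_ge0 ?exprn_ge0// ltW.
Qed.

End acos2_part.

(** * Volume of spherical caps *)

Section cube.
Context {R : realType}.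

Definition cube n (a : n.-tuple R) (e : R) : set (n.-tuple R) :=
  [set t | forall i, `|tnth t i - tnth a i| <= e].

Lemma measurable_cube n (a : n.-tuple R) e : measurable (cube a e).
Proof.
rewrite (_ : cube a e = \bigcap_i [set t | `|tnth t i - tnth a i| <= e]).
  apply: fin_bigcap_measurable => // i _; rewrite -[X in measurable X]setTI.
  apply: (@measurable_tnth _ R n i measurableT [set x | `|x - tnth a i| <= e]).
  rewrite (_ : [set x | _] = `[tnth a i - e, tnth a i + e]%classic)//.
  by apply/seteqP; split => x /=; rewrite in_itv/= ler_distl.
by apply/seteqP; split => [t ct i _|t ct i] //; exact: ct.
Qed.

Lemma lebesgue_tuple_cube n (a : n.-tuple R) e : 0 <= e ->
  (lebesgue_tuple R n (cube a e) <= ((2 * e) ^+ n)%:E)%E.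
Proof.
move=> e0; elim: n a => [|n IH] a.
  by rewrite expr0 /= diracE; case: (_ \in _).
have iS (i : 'I_n) : inord i.+1 = lift ord0 i.
  by apply: val_inj; rewrite /= inordK ?ltnS.
pose a' : n.-tuple R := [tuple of behead a].
rewrite (_ : lebesgue_tuple R n.+1 (cube a e) =
  (lebesgue_measure \x lebesgue_tuple R n)%E
    (`[thead a - e, thead a + e]%classic `*` cube a' e)); last first.
  rewrite [LHS](_ : _ = (lebesgue_measure \x lebesgue_tuple R n)%E
    (@tuple_cons R n @^-1` cube a e))//; congr (_ _).
  apply/seteqP; split => -[x t]/=.
    move=> ct; split.
      by have := ct ord0; rewrite in_itv/= ler_distl.
    by move=> i; have := ct (lift ord0 i); rewrite tnthS tnth_behead iS.
  move=> [xa ct] i; have [j ->|->] := unliftP ord0 i; last first.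
    by move: xa; rewrite in_itv/= -ler_distl.
  by rewrite tnthS; have := ct j; rewrite tnth_behead iS.
rewrite product_measure1E//; last exact: measurable_cube.
rewrite exprS EFinM lee_pmul//.
rewrite [leLHS](_ : _ = lebesgue_measure
  ([set` `[thead a - e, thead a + e]] : set R))//.
rewrite lebesgue_measure_itv/= lte_fin; case: ifPn => _.
  by rewrite -EFinB lee_fin; lra.
by rewrite lee_fin mulr_ge0.
Qed.

End cube.

(** * Euclidean identities in stereographic coordinates *)

Section sphere_geometry.
Context {R : realType} {d : nat}.
Implicit Types (u v w : 'rV[R]_d) (x y z : 'rV[R]_d.+1).

Lemma measurable_sphere_coord (i : 'I_d.+1) :
  measurable_fun [set: sphere R d] (fun y : sphere R d => set_val y 0 i : R).
Proof.
apply: (measurability _ (RGenOpens.measurableE R)).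
move=> _ [_ [a [b ->] <-]]; rewrite setTI; apply: sub_sigma_algebra.
exists ((fun x : 'rV[R]_d.+1 => x 0 i) @^-1` `]a, b[%classic) => //.
apply: open_comp; last exact: interval_open.
by move=> x _; exact: coord_continuous.
Qed.

Definition normsq n (x : 'rV[R]_n) := dot x x.

Lemma measurable_normsq_sphere z :
  measurable_fun [set: sphere R d] (fun y : sphere R d => normsq (set_val y + z)).
Proof.
rewrite /normsq /dot; under eq_fun do under eq_bigr do rewrite mxE.
apply: measurable_sum => i; apply: measurable_funM;
  by apply: measurable_funD => //; exact: measurable_sphere_coord.
Qed.

Lemma measurable_cap z (rho : R) :
  measurable [set y : sphere R d | normsq (set_val y + z) < rho].
Proof.
have := measurable_normsq_sphere z measurableT.
move=> /(_ `]-oo, rho[%classic (measurable_itv _)).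
by rewrite setTI preimage_itvNyo.
Qed.

Lemma normsqD n (x y : 'rV[R]_n) : normsq (x + y) = normsq x + 2 * dot x y + normsq y.
Proof.
rewrite /normsq /dot mulr_sumr -!big_split/=.
by apply: eq_bigr => i _; rewrite mxE; ring.
Qed.

(** In each coordinate the right side minus the left side is (x_i + 2 y_i)^2. *)
Lemma normsq_le2 n (x y : 'rV[R]_n) : normsq x <= 2 * normsq (x + y) + 2 * normsq y.
Proof.
rewrite /normsq /dot !mulr_sumr -!big_split/=; apply: ler_sum => i _.
rewrite mxE; have := sqr_ge0 (x 0 i + 2 * y 0 i); lra.
Qed.

Lemma normsqN n (x : 'rV[R]_n) : normsq (- x) = normsq x.
Proof. by apply: eq_bigr => i _; rewrite mxE mulrNN. Qed.

Lemma normsq_ge0 n (x : 'rV[R]_n) : 0 <= normsq x. Proof. exact: dot_ge0. Qed.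

Lemma sqr_coord_le n (x : 'rV[R]_n) i : x 0 i ^+ 2 <= normsq x.
Proof.
rewrite /normsq /dot (bigD1 i)//= -expr2 lerDl; apply: sumr_ge0 => j _.
by rewrite -expr2 sqr_ge0.
Qed.

Lemma normsq_le_norm n (x : 'rV[R]_n) : normsq x <= n%:R * `|x| ^+ 2.
Proof.
rewrite mulr_natl -[X in _ *+ X]card_ord -sumr_const; apply: ler_sum => i _.
rewrite -expr2 -[leLHS]ger0_norm ?sqr_ge0// normrX.
by rewrite lerXn2r ?nnegrE// le_coord_norm.
Qed.

Lemma dotC n (x y : 'rV[R]_n) : dot x y = dot y x.
Proof. by apply: eq_bigr => i _; rewrite mulrC. Qed.

Lemma dot_stereo s v w : dot (stereo_vec s v) (stereo_vec s w) =
  ((normsq v - 1) * (normsq w - 1) + 4 * dot v w) /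
  ((1 + normsq v) * (1 + normsq w)).
Proof.
rewrite {1}/dot big_ord_recl !stereo_vec0; under eq_bigr do rewrite !stereo_vecS.
rewrite -/(normsq v) -/(normsq w).
have v0 : 1 + normsq v != 0 by rewrite gt_eqF// dotp1_gt0.
have w0 : 1 + normsq w != 0 by rewrite gt_eqF// dotp1_gt0.
rewrite (_ : \sum_i _ =
    (1 + normsq v)^-1 * (1 + normsq w)^-1 * 4 * dot v w); last first.
  by rewrite /dot mulr_sumr; apply: eq_bigr => i _; ring.
have ss : (-1) ^+ s * (-1) ^+ s = 1 :> R by rewrite -expr2 sqrr_sign.
rewrite [X in X + _](_ : _ = ((-1) ^+ s * (-1) ^+ s) * ((1 + normsq v)^-1 *
  (1 + normsq w)^-1 * ((normsq v - 1) * (normsq w - 1)))); last by ring.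
by rewrite ss; field; rewrite v0 w0.
Qed.

Lemma normsq_stereo s v : normsq (stereo_vec s v) = 1.
Proof. exact: sphereP (stereo s v). Qed.

Lemma normsq_stereoB s v w : normsq (stereo_vec s v - stereo_vec s w) =
  4 * normsq (v - w) / ((1 + normsq v) * (1 + normsq w)).
Proof.
have dotN n (x y : 'rV[R]_n) : dot x (- y) = - dot x y.
  by rewrite /dot -sumrN; apply: eq_bigr => i _; rewrite mxE mulrN.
have v0 : 1 + normsq v != 0 by rewrite gt_eqF// dotp1_gt0.
have w0 : 1 + normsq w != 0 by rewrite gt_eqF// dotp1_gt0.
rewrite !normsqD !dotN !normsqN !normsq_stereo dot_stereo.
by field; rewrite v0 w0.
Qed.

End sphere_geometry.

(** * Caps cut by shells *)

Section cap_volume.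
Context {R : realType} {d : nat}.
Implicit Types (t u : d.-tuple R) (z : 'rV[R]_d.+1) (k : nat).

Lemma measurable_row_of_tuple (g : 'rV[R]_d -> R) : continuous g ->
  measurable_fun [set: d.-tuple R] (g \o row_of_tuple).
Proof.
move=> cg; apply: (measurability _ (RGenOpens.measurableE R)).
move=> _ [_ [a [b ->] <-]]; rewrite setTI comp_preimage.
apply: open_measurable_row_of_tuple; apply: open_comp => [v _|]; first exact: cg.
exact: interval_open.
Qed.

Definition stereo_denom t : R := 1 + normsq (row_of_tuple t).
Local Notation Q := stereo_denom.

Lemma stereo_denom_ge1 t : 1 <= Q t.
Proof. by rewrite lerDl normsq_ge0. Qed.

Let continuous_denom : continuous (fun v : 'rV[R]_d => 1 + normsq v).
Proof.
move=> v; apply: continuousD; first exact: cst_continuous.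
by apply: differentiable_continuous; have [] := is_diff_dot v.
Qed.

Lemma measurable_stereo_denom : measurable_fun setT Q.
Proof. exact: measurable_row_of_tuple continuous_denom. Qed.

Lemma measurable_stereo_density : measurable_fun setT (fun t => (2 / Q t) ^+ d).
Proof.
apply: measurable_funX.
apply: (@measurable_row_of_tuple (fun v => 2 / (1 + normsq v))) => v.
have v0 : 1 + normsq v != 0 by rewrite gt_eqF// dotp1_gt0.
suff : {for v, continuous (fun v => 2 / (1 + normsq v))} by [].
apply: continuousM; first exact: cst_continuous.
by apply: continuousV => //; exact: continuous_denom.
Qed.

Definition shell k : set (d.-tuple R) := [set t | 16 ^+ k <= Q t < 16 ^+ k.+1].

Lemma measurable_shell k : measurable (shell k).
Proof.
rewrite -[shell k]setTI; have := measurable_stereo_denom measurableT.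
move=> /(_ `[16 ^+ k, 16 ^+ k.+1[%classic (measurable_itv _)).
by rewrite (_ : _ @^-1` _ = shell k)//; apply/seteqP; split => t /=; rewrite in_itv.
Qed.

Lemma shell_ex t : exists k, shell k t.
Proof.
have ex : exists k, Q t < 16 ^+ k.+1.
  exists (Num.bound (Q t)).
  have Q0 : 0 <= Q t by rewrite (le_trans _ (stereo_denom_ge1 t)).
  rewrite (lt_le_trans (archi_boundP Q0))// -natrX ler_nat ltnW//.
  by rewrite (ltn_trans (ltnSn _))// ltn_expl.
exists (ex_minn ex); rewrite /shell/=; case: ex_minnP => k -> kmin; rewrite andbT.
case: k kmin => [|k] kmin; first by rewrite expr0 stereo_denom_ge1.
by rewrite leNgt; apply/negP => /kmin; rewrite ltnn.
Qed.

Lemma shell_coord k t i : shell k t -> `|tnth t i| <= 4 ^+ k.+1.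
Proof.
move=> /andP[_ tk]; rewrite -(@ler_pXn2r _ 2)// ?nnegrE ?exprn_ge0//.
rewrite -normrX ger0_norm ?sqr_ge0// -exprM mulnC exprM -[4 ^+ 2]natrX ltW//.
apply: le_lt_trans tk; rewrite /Q ler_wpDl//.
by have := sqr_coord_le (row_of_tuple t) i; rewrite mxE.
Qed.

(** Two points of the cap are at chordal distance at most 2 rho, and the stereographic formula
    converts this with the factor (1 + |v|^2) (1 + |w|^2), at most 16^(2k + 2) on the shell. *)
Lemma cap_shell_coord z (rho : R) k t u i : 0 < rho ->
  shell k t -> shell k u ->
  normsq (stereo_vec false (row_of_tuple t) + z) < rho ^+ 2 ->
  normsq (stereo_vec false (row_of_tuple u) + z) < rho ^+ 2 ->
  `|tnth t i - tnth u i| <= rho * 16 ^+ k.+1.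
Proof.
move=> rho0 /andP[_ tk] /andP[_ uk]; set v := row_of_tuple t; set w := row_of_tuple u.
move=> tz uz.
rewrite -(@ler_pXn2r _ 2)// ?nnegrE ?mulr_ge0 ?exprn_ge0// ?(ltW rho0)//.
rewrite -normrX ger0_norm ?sqr_ge0//.
have Qt : 0 < 1 + normsq v by rewrite dotp1_gt0.
have Qu : 0 < 1 + normsq w by rewrite dotp1_gt0.
have vw : normsq (v - w) <= rho ^+ 2 * ((1 + normsq v) * (1 + normsq w)).
  rewrite -ler_pdivrMr ?mulr_gt0//.
  have := normsq_le2 (stereo_vec false v - stereo_vec false w) (stereo_vec false w + z).
  rewrite addrA subrK normsq_stereoB -mulrA; lra.
have := sqr_coord_le (v - w) i; rewrite !mxE => /le_trans; apply.
rewrite (le_trans vw)// exprMn ler_wpM2l ?sqr_ge0// expr2.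
by rewrite ler_pM// ltW.
Qed.

(** On the shell the volume density is at most (2 / 16^k)^d, so a cube around the piece gives
    O(min(rho, 4^(-k))^d). Bounding all d factors by rho would leave nothing to sum over k; one of
    them is bounded by sqrt rho 2^(-k) instead. *)
Lemma lebesgue_cap_shell z (rho : R) k : 0 < rho -> (0 < d)%N ->
  forall P : set (d.-tuple R), measurable P ->
  (forall t, P t -> shell k t /\
    normsq (stereo_vec false (row_of_tuple t) + z) < rho ^+ 2) ->
  (((2 / 16 ^+ k) ^+ d)%:E * lebesgue_tuple R d P <=
    (2 * 64 ^+ d * rho ^+ d.-1 * Num.sqrt rho / (2 ^ k.+1)%:R)%:E)%E.
Proof.
move=> rho0 d0 P mP HP.
have bound (a : d.-tuple R) (e : R) : 0 <= e -> P `<=` cube a e ->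
    (((2 / 16 ^+ k) ^+ d)%:E * lebesgue_tuple R d P <=
     ((4 * e / 16 ^+ k) ^+ d)%:E)%E.
  move=> e0 Pe; rewrite (_ : 4 * e / 16 ^+ k = (2 / 16 ^+ k) * (2 * e)); last by ring.
  rewrite [X in (_ <= X%:E)%E]exprMn EFinM lee_wpmul2l//.
  apply: le_trans (lebesgue_tuple_cube a e0).
  by apply: le_measure => //; rewrite inE//; exact: measurable_cube.
have [P0|/eqP/set0P[u Pu]] := pselect (P = set0).
  rewrite P0 measure0 mule0 lee_fin divr_ge0// mulr_ge0 ?sqrtr_ge0//.
  by rewrite !mulr_ge0 ?exprn_ge0// ltW.
have s0 := sqrtr_ge0 rho; have s2 : Num.sqrt rho ^+ 2 = rho by rewrite sqr_sqrtr// ltW.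
have k16 : (0 : R) < 16 ^+ k by rewrite exprn_gt0.
have k2 : (0 : R) < 2 ^+ k by rewrite exprn_gt0.
have e16 : 16 ^+ k = (2 ^+ k) ^+ 4 :> R by rewrite -exprM mulnC exprM -[2 ^+ 4]natrX.
have e4 : 4 ^+ k = (2 ^+ k) ^+ 2 :> R by rewrite -exprM mulnC exprM -[2 ^+ 2]natrX.
rewrite natrX exprS [X in (_ <= X%:E)%E](_ : _ =
  64 ^+ d * (rho ^+ d.-1 * (Num.sqrt rho * (2 ^+ k)^-1))); last first.
  by field; rewrite gt_eqF.
(* [min rho (4 ^- k) <= sqrt rho * 2 ^- k]: the first bound comes from the diameter of
   the cap, the second one from that of the shell. *)
have [rk|kr] := leP (Num.sqrt rho) (2 ^+ k)^-1.
  apply: le_trans (bound u (rho * 16 ^+ k.+1) _ _) _.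
  - by rewrite mulr_ge0 ?exprn_ge0// ltW.
  - move=> t Pt i; have [tk tz] := HP t Pt; have [uk uz] := HP u Pu.
    exact: cap_shell_coord tz uz.
  rewrite lee_fin exprS (_ : 4 * _ / _ = 64 * rho); last by field; rewrite gt_eqF.
  rewrite exprMn ler_wpM2l ?exprn_ge0// -[in leLHS](prednK d0) exprSr.
  by rewrite ler_wpM2l ?exprn_ge0 ?(ltW rho0)// -{1}s2 expr2 ler_wpM2l.
apply: le_trans (bound [tuple of nseq d 0] (4 ^+ k.+1) _ _) _.
- exact: exprn_ge0.
- by move=> t Pt i; rewrite tnth_nseq subr0; apply: shell_coord (HP t Pt).1.
rewrite lee_fin exprS e16 e4 (_ : 4 * _ / _ = 16 * ((2 ^+ k)^-1 * (2 ^+ k)^-1)); last first.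
  by field; rewrite gt_eqF.
rewrite exprMn ler_pM ?exprn_ge0//; first by rewrite lerXn2r ?nnegrE// ler_nat.
rewrite -[in leLHS](prednK d0) exprSr.
have i0 : (0 : R) <= (2 ^+ k)^-1 by rewrite invr_ge0 ltW.
rewrite ler_pM ?exprn_ge0 ?mulr_ge0//; last by rewrite ler_wpM2r// ltW.
rewrite lerXn2r ?nnegrE ?mulr_ge0 ?(ltW rho0)// -s2 expr2.
by rewrite ler_pM// ltW.
Qed.

Lemma sphere_volume_cap : (0 < d)%N -> forall z (rho : R), 0 < rho ->
  (@sphere_volume R d [set y : sphere R d | (normsq (set_val y + z) < rho ^+ 2)%R] <=
   (2 * 64 ^+ d * rho ^+ d.-1 * Num.sqrt rho)%:E)%E.
Proof.
move=> d0 z rho rho0.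
set E := [set y | _]; pose P := sphere_chart false @^-1` E.
have mE : measurable E by exact: measurable_cap.
have mP : measurable P.
  by rewrite -[P]setTI; exact: measurable_sphere_chart.
have mPk k : measurable (P `&` shell k).
  by apply: measurableI => //; exact: measurable_shell.
pose D k : R := (2 / 16 ^+ k) ^+ d.
have D0 k : 0 <= D k by rewrite exprn_ge0// divr_ge0// exprn_ge0.
have mterm k : measurable_fun setT (fun t => (D k * \1_(P `&` shell k) t)%:E).
  by apply/measurable_EFinP; apply: measurable_funM => //; exact: measurable_indic.
have term0 k t : (0 <= (D k * \1_(P `&` shell k) t)%:E)%E.
  by rewrite lee_fin mulr_ge0.
have Q0 t : 0 < Q t by rewrite (lt_le_trans _ (stereo_denom_ge1 t)).
rewrite [leLHS](_ : _ = \int[lebesgue_tuple R d]_(t in P) ((2 / Q t) ^+ d)%:E)%E;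
  last by apply: eq_integral => t _; rewrite volume_density_stereo.
rewrite integral_mkcond.
(* Every t lies in some shell, where the density is at most [D k], so the series over the shells
   dominates it. *)
apply: (@le_trans _ _ (\int[lebesgue_tuple R d]_t
    (\sum_(0 <= k <oo) (D k * \1_(P `&` shell k) t)%:E))%E).
  apply: ge0_le_integral => //=.
  - move=> t _; rewrite patchE; case: ifPn => // _.
    by rewrite lee_fin exprn_ge0// divr_ge0// ltW.
  - apply/(measurable_restrictT _ _).1 => //; apply/measurable_EFinP.
    exact: measurable_funTS measurable_stereo_density.
  - exact: (@ge0_emeasurable_sum _ _ _ _ _ xpredT).
  move=> t _; rewrite patchE; case: ifPn => [|_]; last exact: nneseries_ge0.
  rewrite inE => Pt; have [k tk] := shell_ex t.
  apply: le_trans (nneseries_lim_ge k.+1 _) => //.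
  rewrite big_nat_recr//=; apply: (@le_trans _ _ (D k * \1_(P `&` shell k) t)%:E).
    rewrite indicE mem_set// mulr1 lee_fin lerXn2r ?nnegrE ?divr_ge0 ?exprn_ge0//.
      exact: ltW.
    by rewrite ler_wpM2l// lef_pV2 ?posrE ?exprn_gt0//; case/andP: tk.
  by rewrite leeDr// sume_ge0.
rewrite integral_nneseries//.
apply: le_trans (epsilon_trick0 xpredT _); last first.
  by rewrite !mulr_ge0 ?exprn_ge0 ?sqrtr_ge0// ltW.
apply: lee_nneseries => [k _ _|k _]; first exact: integral_ge0.
under eq_integral do rewrite EFinM.
have m1 : measurable_fun setT (fun t => (\1_(P `&` shell k) t : R)%:E).
  exact/measurable_EFinP/measurable_indic.
rewrite ge0_integralZl_EFin// integral_indic// setIT.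
by apply: (@lebesgue_cap_shell z) => // t [Pt tk]; split.
Qed.

End cap_volume.

(** * The squared distance as a kernel *)

Lemma is_derive1_is_diff {R : realType} (f : R -> R) (x l : R) :
  is_derive x 1 f l -> is_diff x f (fun h => h * l).
Proof.
move=> [dfx fE]; have df : differentiable f x by exact/derivable1_diffP.
apply: DiffDef => //; apply/funext => h.
by rewrite -[h in LHS]mulr1 -[h * 1]/(h *: 1) linearZ/= -deriveE// fE.
Qed.

Section sphere_kernel.
Context {R : realType} {d : nat} (s : bool).
Implicit Types (v : 'rV[R]_d) (y : sphere R d).

Definition chord v y : R := Num.sqrt (normsq (set_val y + stereo_vec s v)).

Definition height v y : R := dot (set_val y) (stereo_vec s v).

Lemma chord_ge0 v y : 0 <= chord v y. Proof. exact: sqrtr_ge0. Qed.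

Lemma chord_sqr v y : chord v y ^+ 2 = 2 + 2 * height v y.
Proof.
rewrite sqr_sqrtr ?normsq_ge0// normsqD normsq_stereo.
by rewrite [normsq (set_val y)](sphereP y) /height; ring.
Qed.

Lemma height_range v y : -1 <= height v y <= 1.
Proof.
have p := sqr_ge0 (chord v y); rewrite chord_sqr in p.
have := normsq_ge0 (set_val y - stereo_vec s v).
rewrite normsqD normsqN normsq_stereo [normsq (set_val y)](sphereP y).
rewrite (_ : dot _ _ = - height v y).
  by move=> m; apply/andP; split; lra.
by rewrite /height /dot -sumrN; apply: eq_bigr => i _; rewrite mxE mulrN.
Qed.

Lemma chord_le2 v y : chord v y <= 2.
Proof.
rewrite -(@ler_pXn2r _ 2)// ?nnegrE ?chord_ge0// chord_sqr.
by have /andP[_ h1] := height_range v y; lra.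
Qed.

(** The denominators of the chordal formula are at least 1, so stereographic projection is
    2-Lipschitz from the Euclidean norm; the factor d + 1 covers the passage to the sup norm. *)
Lemma chord_lipschitz v w y :
  chord v y ^+ 2 <= 2 * chord w y ^+ 2 + 2 * ((2 * d.+1%:R) * `|v - w|) ^+ 2.
Proof.
rewrite ![chord _ _ ^+ 2]sqr_sqrtr ?normsq_ge0//.
have e : set_val y + stereo_vec s v + (stereo_vec s w - stereo_vec s v) =
    set_val y + stereo_vec s w by rewrite [_ - stereo_vec s v]addrC addrA addrK.
have := normsq_le2 (set_val y + stereo_vec s v) (stereo_vec s w - stereo_vec s v).
rewrite e => /le_trans; apply; rewrite lerD2l ler_wpM2l//.
have q1 (u : 'rV[R]_d) : 1 <= 1 + normsq u by rewrite lerDl normsq_ge0.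
have q0 (u : 'rV[R]_d) : 0 < 1 + normsq u by exact: dotp1_gt0.
rewrite normsq_stereoB ler_pdivrMr ?mulr_gt0//.
rewrite (le_trans (_ : _ <= (2 * d.+1%:R * `|v - w|) ^+ 2 * 1))//; last first.
  by rewrite ler_wpM2l ?sqr_ge0// mulr_ege1.
rewrite mulr1 exprMn exprMn -mulrA -[2 ^+ 2]natrX ler_wpM2l//.
rewrite distrC (le_trans (normsq_le_norm _))// ler_wpM2r ?sqr_ge0//.
by rewrite -natrX ler_nat expnS (leq_trans (leqnSn d))// leq_pmulr.
Qed.

Lemma measurable_height v : measurable_fun setT (height v).
Proof.
apply: measurable_sum => i; apply: measurable_funM => //.
exact: measurable_sphere_coord.
Qed.

Lemma measurable_chord v : measurable_fun setT (chord v).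
Proof. 
apply: (@measurableT_comp _ _ _ _ _ _ (@Num.sqrt R)).
  by apply: continuous_measurable_fun; exact: sqrt_continuous.
exact: measurable_normsq_sphere.
Qed.

(** Boundedness of [U] makes the coordinates of v bounded kernels, hence also everything built from
    them. *)
Variables (U : set 'rV[R]_d) (K : R).
Hypothesis UK : forall v, U v -> `|v| <= K.
Local Notation kern := (kernel U chord).

Lemma kernel00M n k1 k2 : kern 0 n 0 k1 -> kern 0 n 0 k2 ->
  kern 0 n 0 (fun v y => k1 v y * k2 v y).
Proof. by move=> H1 H2; have := kernelM H1 H2; rewrite addr0. Qed.

Lemma kernel_cst n (a : R) : kern 0 n 0 (fun _ _ => a).
Proof. by apply: kernel_param => //; exists `|a|. Qed.

Lemma kernel_coord n i : kern 0 n 0 (fun v _ => v 0 i).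
Proof.
case: n => [|n]; split => //;
  try by exists K => v y Uv _; rewrite expr0z mulr1 (le_trans (le_coord_norm _ _))// UK.
exists (fun l _ _ => (l == i)%:R); split => [l|v y Uv ry].
  by rewrite subr0; exact: kernel_cst.
apply: is_diff_ext (is_diff_coord i v) _ _ => [//|h].
rewrite /linform (bigD1 i)//= eqxx mulr1 big1 ?addr0// => l /negbTE ->.
by rewrite mulr0.
Qed.

(** The partial derivatives are products of the function itself and coordinates, so the induction
    closes. *)
Lemma kernel_denom_inv n : kern 0 n 0 (fun v _ => (1 + normsq v)^-1).
Proof.
have b : exists C, forall v y, U v -> 0 < chord v y ->
    `|(1 + normsq v)^-1| <= C * chord v y ^ 0.
  exists 1 => v y _ _; rewrite expr0z mulr1 normfV.
  have q0 : 0 < 1 + normsq v := dotp1_gt0 v.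
  by rewrite ger0_norm ?(ltW q0)// invf_le1// lerDl normsq_ge0.
elim: n => [|n IH]; split => //.
exists (fun i v _ => - ((1 + normsq v)^-1 * (1 + normsq v)^-1) * (2 * v 0 i)).
split => [i|v y Uv ry].
  rewrite subr0.
  apply: (@kernel_ext _ _ _ _ _ _ _ _ _ (fun v _ => -1 * (((1 + normsq v)^-1 *
      (1 + normsq v)^-1) * (2 * v 0 i)))).
    by move=> v y; ring.
  by apply/kernelZ/kernel00M; [exact: kernel00M|exact/kernelZ/kernel_coord].
have q0 : 1 + dot v v != 0 by rewrite gt_eqF// dotp1_gt0.
have Dq : is_diff v (fun u => 1 + dot u u) (fun h => 2 * dot v h).
  by apply: is_diff_ext (is_diffD (is_diff_cst (1 : R) v) (is_diff_dot v)) _ _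
    => [//|h]; rewrite [LHS]add0r.
apply: is_diff_ext (@is_diff_inv _ _ (fun u => 1 + dot u u) _ v q0 Dq) _ _ => [//|h].
rewrite /linform /dot !mulr_sumr; apply: eq_bigr => i _.
by rewrite -/(dot v v) /normsq; field.
Qed.

Lemma kernel_height n : kern 0 n 0 height.
Proof.
have my i : kern 0 n 0 (fun _ y => set_val y 0 i).
  apply: kernel_param; first exact: measurable_sphere_coord.
  exists 1 => y; rewrite -(@ler_pXn2r _ 2)// ?nnegrE// -normrX ger0_norm ?sqr_ge0//.
  by rewrite expr1n -(sphereP y) sqr_coord_le.
have mN : kern 0 n 0 (fun v _ => normsq v).
  by apply: kernel_sum => i; apply: kernel00M; exact: kernel_coord.
have mS i : kern 0 n 0 (fun v _ => stereo_vec s v 0 i).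
  have [j ->|->] := unliftP ord0 i.
    apply: (@kernel_ext _ _ _ _ _ _ _ _ _
      (fun v _ => (1 + normsq v)^-1 * (2 * v 0 j))).
      by move=> v y; rewrite stereo_vecS.
    by apply: kernel00M; [exact: kernel_denom_inv|exact/kernelZ/kernel_coord].
  apply: (@kernel_ext _ _ _ _ _ _ _ _ _
    (fun v _ => (1 + normsq v)^-1 * ((-1) ^+ s * (normsq v + -1)))).
    by move=> v y; rewrite stereo_vec0.
  apply: kernel00M; first exact: kernel_denom_inv.
  by apply/kernelZ/kernelD => //; exact: kernel_cst.
by apply: kernel_sum => i; exact: kernel00M.
Qed.


Definition stereo_partial v (i : 'I_d) : 'rV[R]_d.+1 :=
  'd (stereo_vec s) v (delta_mx 0 i).

Lemma normsq_stereo_partial v i :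
  normsq (stereo_partial v i) = (2 / (1 + normsq v)) ^+ 2.
Proof.
have /matrixP/(_ i i) := pullback_metric_stereo s v.
rewrite [X in _ = X -> _]mxE eqxx mulr1n => <-.
rewrite /pullback_metric mxE; apply: eq_bigr => l _.
have -> : stereo_partial v i = row i ('J (stereo_vec s) v).
  by rewrite /jacobian rowE mul_rV_lin1.
by rewrite !mxE.
Qed.

Lemma is_diff_dotl n (x : 'rV[R]_n) (x0 : 'rV[R]_n) : is_diff x0 (dot x) (dot x).
Proof.
have dE (u : 'rV[R]_n) : linform (fun l => x 0 l) u = dot x u.
  by apply: eq_bigr => l _; rewrite mulrC.
exact: (is_diff_ext (is_diff_linform (fun l => x 0 l) x0) dE dE).
Qed.

Lemma is_diff_height v y :
  is_diff v (height^~ y) (fun h => dot (set_val y) ('d (stereo_vec s) v h)).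
Proof.
have [Ds _] := is_diff_stereo_vec s v.
exact: (is_diff_comp (differentiableP Ds) (is_diff_dotl (set_val y) _)).
Qed.

(** Differentiation of |x|^2 = 1. *)
Lemma dot_stereo_partial v i : dot (stereo_vec s v) (stereo_partial v i) = 0.
Proof.
have [Ds _] := is_diff_stereo_vec s v.
have [_ D1] := is_diff_comp (differentiableP Ds) (is_diff_dot (stereo_vec s v)).
have [_ D2] := is_diff_cst (1 : R) v.
move: D1; rewrite (_ : _ \o _ = cst 1); last first.
  by apply/funext => u; rewrite /= [dot _ _]normsq_stereo.
rewrite D2 => /(congr1 (fun f => f (delta_mx 0 i)))/= /esym/eqP.
by rewrite mulf_eq0 pnatr_eq0/= => /eqP.
Qed.

Lemma height_partial_le v y i :
  `|dot (set_val y) (stereo_partial v i)| <= 2 * d.+1%:R * chord v y.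
Proof.
have coord_le (x : 'rV[R]_d.+1) l : `|x 0 l| <= Num.sqrt (normsq x).
  by rewrite -sqrtr_sqr; apply: ler_wsqrtr; exact: sqr_coord_le.
(* Tangency allows y to be replaced by y + x, whose norm is the chord. *)
rewrite (_ : dot _ _ = dot (set_val y + stereo_vec s v) (stereo_partial v i)).
  rewrite (le_trans (ler_norm_sum _ _ _))//.
  rewrite -mulrA mulrCA mulr_natl -[X in _ *+ X]card_ord -sumr_const.
  apply: ler_sum => l _; rewrite normrM mulrC ler_pM//.
  rewrite (le_trans (coord_le _ _))// normsq_stereo_partial sqrtr_sqr.
  have q0 : 0 < 1 + normsq v by exact: dotp1_gt0.
  rewrite ger0_norm ?divr_ge0 ?(ltW q0)// ler_pdivrMr// ler_peMr//.
  by rewrite lerDl normsq_ge0.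
rewrite -[LHS]addr0 -(dot_stereo_partial v i) /dot -big_split/=.
by apply: eq_bigr => l _; rewrite [(_ + stereo_vec s v) 0 l]mxE mulrDl.
Qed.

(** The gain of one power of r concerns the first derivatives only. The later ones are bounded,
    which suffices, since the exponent required of them is 0 or less. *)
Lemma kernel_height_partial n : exists DT : 'I_d -> 'rV[R]_d -> sphere R d -> R,
  (forall i, kern 1 n 1 (DT i)) /\
  forall v y, U v -> 0 < chord v y ->
    is_diff v (height^~ y) (linform (fun i => DT i v y)).
Proof.
have [mT _ [DT [kD dT]]] := kernel_height n.+1.
have linform_delta (c : 'I_d -> R) i : linform c (delta_mx 0 i) = c i.
  rewrite /linform (bigD1 i)//= big1 ?addr0 => [|l /negbTE li].
    by rewrite mxE !eqxx mul1r.
  by rewrite mxE li andbF mul0r.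
exists DT; split => // i; have := kD i; rewrite subr0 => kDi.
have [mD _ _] := kernel_base kDi.
have bD : exists C, forall v y, U v -> 0 < chord v y ->
    `|DT i v y| <= C * chord v y ^ 1.
  exists (2 * d.+1%:R) => v y Uv ry; rewrite expr1z.
  (* [DT] is known only by existence; uniqueness of the differential identifies it with the inner
     products of y with the partial derivatives of x. *)
  have [_ E1] := dT v y Uv ry; have [_ E2] := is_diff_height v y.
  rewrite -(linform_delta (fun i => DT i v y) i) -E1 E2.
  exact: height_partial_le.
case: n kDi {kD} => [|n] kDi; split => //.
case: kDi => _ _ [D2 [kD2 dD2]]; exists D2; split => // l.
have := kD2 l; rewrite subr0 subrr; apply: kernel_step => // v y _.
exact: chord_le2.
Qed.

Lemma height_gtN1 v y : 0 < chord v y -> -1 < height v y.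
Proof. by move=> r0; have := exprn_gt0 2 r0; rewrite chord_sqr; lra. Qed.

(** Chain rule: one more derivative of acos^2 / 2 costs r^(-2), and the derivative of the height
    gives back r, a net loss of one power. *)
Lemma kernel_acos2_part n m : kern 1 n (1 - m.*2%:Z)
  (fun v y => acos2_part m (height v y)).
Proof.
have [DT [kD dT]] := kernel_height_partial n.
have ms k v : measurable_fun setT (fun y => acos2_part k (height v y)).
  exact: measurableT_comp (measurable_acos2_part k) (measurable_height v).
have bd k : exists C, forall v y, U v -> 0 < chord v y ->
    `|acos2_part k (height v y)| <= C * chord v y ^ (1 - k.*2%:Z).
  have [C HC] := @acos2_part_bound R k; exists C => v y Uv ry; apply: HC => //.
    by rewrite height_gtN1//; case/andP: (height_range v y).
  exact: chord_sqr.
elim: n m kD => [|n IH] m kD; first by split.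
split => //; exists (fun i v y => acos2_part m.+1 (height v y) * DT i v y).
split => [i|v y Uv ry].
  rewrite (_ : 1 - m.*2%:Z - 1 = (1 - m.+1.*2%:Z) + 1); last first.
    by rewrite doubleS 2!intS; ring.
  apply: kernelM; last exact/kernelW/kD.
  by apply: IH => l; exact/kernelW/kD.
have t3 : -1 < height v y < 3.
  have /andP[_ t1] := height_range v y.
  by rewrite height_gtN1//= (le_lt_trans t1)// ltr1n.
have D := is_diff_comp (dT v y Uv ry)
  (is_derive1_is_diff (is_derive_acos2_part m t3)).
apply: is_diff_ext D _ _ => [//|h].
by rewrite /= /linform mulr_suml; apply: eq_bigr => i _; rewrite mulrAC mulrA.
Qed.

Lemma kernel_acos n : kern 1 n 1
  (fun v y => acos (height v y) ^+ 2 / 2 - pi ^+ 2 / 2).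
Proof.
have := kernel_acos2_part n 0; rewrite double0 subr0; apply: kernel_ext => v y.
exact/acos2_part0/height_range.
Qed.

End sphere_kernel.

(** * The Frechet function *)

(** This reduces the chart domain, possibly unbounded, to bounded open pieces, on which the kernel
    estimates hold. *)
Lemma differentiable_order_local {R : realType} (V : normedModType R) j
    (U : set V) (g : V -> R) :
  (forall x, U x -> exists2 W, W x & differentiable_order j W g) ->
  differentiable_order j U g.
Proof.
elim: j g => //= j IH g H; split => [x Ux|h].
  by have [W Wx [dg _]] := H x Ux; exact: dg.
by apply: IH => x Ux; have [W Wx [_ dg]] := H x Ux; exists W.
Qed.

Lemma differentiable_orderDc {R : realType} (V : normedModType R) j
    (U : set V) (g : V -> R) c : open U ->
  differentiable_order j U g -> differentiable_order j U (fun x => g x + c).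
Proof.
case: j => //= j oU [dg Hg].
have D x : U x -> is_diff x (fun x => g x + c) ('d g x).
  move=> Ux; apply: is_diff_ext (is_diffD (differentiableP (dg x Ux))
    (is_diff_cst c x)) _ _ => [//|h].
  by rewrite fctE /= addr0.
split => [x /D[]//|h]; apply: (differentiable_order_ext oU) (Hg h) => x /D[_ ->//].
Qed.

Section frechet.
Context {R : realType} {d : nat}.
Implicit Types (x y p : sphere R d).

Lemma geodesic_ball_antipode p (eps : R) : 0 < eps ->
  exists2 dl : R, 0 < dl & forall x y, normsq (set_val x - set_val p) < dl ->
    normsq (set_val y + set_val x) < dl -> geodesic_ball (antipode p) eps y.
Proof.
(* The minimum with 1 keeps e in [0, pi], where cos is decreasing. *)
move=> eps0; pose e := Num.min eps 1.
have e0 : 0 < e by rewrite lt_min eps0 ltr01.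
have epi : e <= pi.
  have p1 : (1 : R) <= pi by have := pi_ge2 R; lra.
  by rewrite ge_min p1 orbT.
have ce : cos e < 1.
  by rewrite -[ltRHS]cos0 ltr_cos// in_itv/= ?lexx ?pi_ge0// (ltW e0).
(* The two hypotheses give |y + p|^2 < 4 dl = 2 - 2 cos e, while |y + p|^2 = 2 - 2 <-p, y>. *)
exists ((2 - 2 * cos e) / 4); first by lra.
move=> x y xp yx.
have := normsq_le2 (set_val y + set_val p) (set_val x - set_val p).
rewrite [_ - set_val p]addrC addrA addrK [- set_val p + _]addrC => H.
pose c := dot (set_val (antipode p)) (set_val y).
have E : normsq (set_val y + set_val p) = 2 - 2 * c.
  rewrite normsqD [normsq (set_val y)](sphereP y) [normsq (set_val p)](sphereP p).
  rewrite (_ : c = - dot (set_val y) (set_val p)); first by ring.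
  by rewrite /c /dot -sumrN; apply: eq_bigr => i _; rewrite mxE mulNr mulrC.
have cI : -1 <= c <= 1.
  have p1 := normsq_ge0 (set_val y + set_val p); rewrite E in p1.
  have := normsq_ge0 (set_val y + set_val (antipode p)).
  rewrite normsqD [normsq (set_val y)](sphereP y).
  rewrite [normsq (set_val (antipode p))](sphereP (antipode p)) dotC -/c => p2.
  by apply/andP; split; lra.
rewrite /geodesic_ball /= /geodesic_dist -/c.
rewrite (@lt_le_trans _ _ e)//; last by rewrite ge_min lexx.
rewrite -ltr_cos ?in_itv/= ?acos_ge0 ?acos_lepi ?(ltW e0)//.
rewrite acosK ?in_itv//; lra.
Qed.

Lemma open_sphere_nbhd p (dl : R) :
  open [set x : sphere R d | normsq (set_val x - set_val p) < dl].
Proof.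
exists [set z : 'rV[R]_d.+1 | normsq (z - set_val p) < dl] => //.
pose g (z : 'rV[R]_d.+1) := normsq (z - set_val p).
rewrite (_ : [set z | _] = g @^-1` `]-oo, dl[%classic); last first.
  by apply/seteqP; split => z /=; rewrite in_itv.
apply: open_comp => [z _|]; last exact: interval_open.
suff : {for z, continuous (@normsq R d.+1 \o (fun z => z - set_val p))} by [].
apply: continuous_comp.
  by apply: continuousB; [exact: cvg_id|exact: cst_continuous].
by apply: differentiable_continuous; have [] := is_diff_dot (z - set_val p).
Qed.

Lemma mass_cap_bound (mu : probability (sphere R d) R) (f : sphere R d -> R) p j :
  (0 < d)%N -> (0 < j)%N -> is_density mu f ->
  (exists eps : R, 0 < eps /\
      ((j <= d)%N -> exists M : R,
         forall y, geodesic_ball (antipode p) eps y -> `|f y| <= M) /\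
      ((d < j)%N ->
         forall y, geodesic_ball (antipode p) eps y -> f y = 0)) ->
  exists2 dl : R, 0 < dl & exists2 C : R, 0 <= C &
    forall x, normsq (set_val x - set_val p) < dl ->
    forall rho : R, 0 < rho ->
    (mu [set y | (normsq (set_val y + set_val x) < rho ^+ 2)%R] <=
      (C * rho ^+ j.-1 * Num.sqrt rho)%:E)%E.
Proof.
move=> d0 j0 [mf f0 muE] [eps [eps0 [Hd Hj]]].
have [dl dl0 Hdl] := geodesic_ball_antipode p eps0.
exists dl => //.
(* Below sqrt dl the caps lie in the ball where [f] is controlled; below 1, rho^(d - 1) <= rho^(j -
   1) when j <= d. *)
pose rho0 := Num.min 1 (Num.sqrt dl).
have r00 : 0 < rho0 by rewrite lt_min ltr01 sqrtr_gt0.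
have w0 : 0 < rho0 ^+ j.-1 * Num.sqrt rho0 by rewrite mulr_gt0 ?exprn_gt0 ?sqrtr_gt0.
have [M [M0 HM]] : exists M : R, 0 <= M /\ forall x rho,
    normsq (set_val x - set_val p) < dl -> 0 < rho < rho0 ->
    (mu [set y : sphere R d | (normsq (set_val y + set_val x) < rho ^+ 2)%R] <=
      (M * rho ^+ j.-1 * Num.sqrt rho)%:E)%E.
  have inball x rho y : normsq (set_val x - set_val p) < dl -> 0 < rho < rho0 ->
      normsq (set_val y + set_val x) < rho ^+ 2 ->
      geodesic_ball (antipode p) eps y.
    move=> xp /andP[rho_gt0]; rewrite lt_min => /andP[_ rd] yr.
    apply: Hdl xp _; rewrite (lt_trans yr)// -(sqr_sqrtr (ltW dl0)).
    by rewrite ltrXn2r// ?nnegrE ?sqrtr_ge0// ltW.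
  have [dj|jd] := ltnP d j.
    exists 0; split => // x rho xp r1; rewrite muE; last exact: measurable_cap.
    rewrite !mul0r integral0_eq// => y /= yr.
    by rewrite (Hj dj _ (inball x rho y xp r1 yr)).
  have [M M0 HM] : exists2 M, 0 <= M &
      forall y, geodesic_ball (antipode p) eps y -> `|f y| <= M.
    have [M HM] := Hd jd; exists `|M| => // y /HM /le_trans; apply.
    exact: ler_norm.
  exists (M * (2 * 64 ^+ d)); split.
    by rewrite !mulr_ge0// exprn_ge0.
  move=> x rho xp r1; rewrite muE; last exact: measurable_cap.
  set E := [set y | _]; have mE : measurable E by exact: measurable_cap.
  apply: (@le_trans _ _ (\int[@sphere_volume R d]_(y in E) (cst M%:E) y)%E).
    apply: ge0_le_integral => //.
    - by move=> y _; rewrite lee_fin f0.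
    - by apply/measurable_EFinP; exact: measurable_funTS.
    - by move=> y /(inball x rho y xp r1) /HM; rewrite lee_fin ger0_norm.
  rewrite integral_cst//.
  have /andP[rho_gt0 rr] := r1.
  apply: (@le_trans _ _ (M%:E * (2 * 64 ^+ d * rho ^+ d.-1 * Num.sqrt rho)%:E)%E).
    by rewrite lee_wpmul2l ?lee_fin// sphere_volume_cap.
  rewrite -EFinM lee_fin -!mulrA !(ler_wpM2l M0)// !ler_wpM2l// ?exprn_ge0//.
  rewrite ler_wpM2r ?sqrtr_ge0// ler_wiXn2l ?(ltW rho_gt0)//.
    by move: rr; rewrite lt_min => /andP[/ltW].
  by case: (j) (d) d0 j0 jd => [|j'] [|d'].
(* The second summand handles rho >= rho0, where the mass is at most 1. *)
exists (M + (rho0 ^+ j.-1 * Num.sqrt rho0)^-1).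
  by rewrite addr_ge0// invr_ge0 ltW.
move=> x xp rho rho_gt0; have s0 := sqrtr_ge0 rho.
have rj : 0 <= rho ^+ j.-1 by rewrite exprn_ge0 ?ltW.
have [rr0|r0r] := ltP rho rho0.
  have r1 : 0 < rho < rho0 by rewrite rho_gt0.
  apply: le_trans (HM x rho xp r1) _.
  by rewrite lee_fin ler_wpM2r// ler_wpM2r// lerDl invr_ge0 ltW.
apply: (@le_trans _ _ 1%E); first by apply: probability_le1; exact: measurable_cap.
rewrite lee_fin -mulrA mulrDl ler_wpDl ?mulr_ge0//.
rewrite mulrC ler_pdivlMr// mul1r ler_pM ?exprn_ge0 ?sqrtr_ge0 ?(ltW r00)//.
  by rewrite lerXn2r ?nnegrE ?(ltW r00) ?(ltW rho_gt0).
exact: ler_wsqrtr.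
Qed.

Lemma frechet_functionE (mu : probability (sphere R d) R) s v :
  frechet_function mu (stereo s v) =
  \int[mu]_y (acos (height s v y) ^+ 2 / 2).
Proof.
by apply: eq_Rintegral => y _; rewrite mulrC.
Qed.


Lemma frechet_differentiable_order_chart (mu : probability (sphere R d) R) s j
    (dl C : R) p : (0 < j)%N -> 0 <= C ->
  (forall x, normsq (set_val x - set_val p) < dl ->
    forall rho : R, 0 < rho ->
    (mu [set y : sphere R d | (normsq (set_val y + set_val x) < rho ^+ 2)%R] <=
      (C * rho ^+ j.-1 * Num.sqrt rho)%:E)%E) ->
  differentiable_order j
    (stereo s @^-1` [set x | normsq (set_val x - set_val p) < dl])
    (frechet_function mu \o stereo s).
Proof.
move=> j0 C0 H; set U := stereo s @^-1` _.
have oU : open U.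
  have [W oW WE] := open_sphere_nbhd p dl.
  rewrite /U -WE (_ : stereo s @^-1` _ = stereo_vec s @^-1` W)//.
  by apply: open_comp oW => v _; exact: continuous_stereo_vec.
apply: differentiable_order_local => v0 Uv0.
pose V := U `&` ball v0 (1 : R).
have oV : open V by apply: openI => //; exact: ball_open.
have VK v : V v -> `|v| <= `|v0| + 1.
  move=> [_]; rewrite -ball_normE /ball_/= => vv.
  by rewrite -[v](subrK v0) addrC (le_trans (ler_normD _ _))// lerD2l distrC ltW.
exists V; first by split => //; exact: ballxx.
have L1 : 1 <= 2 * d.+1%:R :> R by rewrite -natrM ler1n.
have mu_le v : V v -> (\int[mu]_y layer_weight j.-1 (chord s v) y <=
    (C * 16 ^+ j.-1 * 8)%:E)%E.
  move=> [Uv _]; apply: integral_layer_weight => // [|rho rho0].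
    exact: measurable_chord.
  suff -> : [set y | chord s v y < rho] = [set y : sphere R d |
    normsq (set_val y + set_val (stereo s v)) < rho ^+ 2] by exact: H.
  apply/funext => y; apply/propext; rewrite /=.
  rewrite -[chord s v y < rho](@ltr_pXn2r _ 2)// ?nnegrE ?chord_ge0 ?(ltW rho0)//.
  by rewrite /chord sqr_sqrtr ?normsq_ge0.
have B0 : 0 <= C * 16 ^+ j.-1 * 8 by rewrite !mulr_ge0 ?exprn_ge0.
have K n := kernel_acos s VK n.
have cr2 v y : V v -> chord s v y <= 2 by move=> _; exact: chord_le2.
have D := differentiable_order_integral_kernel oV L1 (chord_lipschitz s)
  (chord_ge0 s) cr2 (measurable_chord s) B0 mu_le.
(* Here m = 0 and q = j - 1, so m + j <= q + 1 holds with equality. *)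
have {}D := D j 0 _ _ (K j.+1).
have {D} := D _.
rewrite add0n prednK// => /(_ (leqnn j)) D.
apply: (differentiable_order_ext oV) (differentiable_orderDc (pi ^+ 2 / 2) oV D).
move=> v Vv; rewrite /= frechet_functionE.
have qj : - j.-1%:Z <= 1 by rewrite (le_trans (_ : _ <= 0))// oppr_le0.
have Ik := kernel_integrable (chord_ge0 s) cr2 (measurable_chord s) mu_le qj
  (K 0%N) Vv.
have Ic : mu.-integrable setT (EFin \o cst (pi ^+ 2 / 2 : R)).
  exact: finite_measure_integrable_cst.
(* The subtracted constant is restored: [mu] has total mass 1. *)
transitivity (\int[mu]_y ((acos (height s v y) ^+ 2 / 2 - pi ^+ 2 / 2) +
    cst (pi ^+ 2 / 2) y)); last by apply: eq_Rintegral => y _; rewrite subrK.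
rewrite (RintegralD measurableT Ik Ic) Rintegral_cst//.
rewrite [X in _ = _ + _ * X](_ : _ = 1) ?mulr1//.
exact: (congr1 fine (probability_setT mu)).
Qed.

End frechet.

Theorem proposition2p4 (R : realType) (d : nat) (hd : (0 < d)%N)
    (mu : probability (sphere R d) R) (f : sphere R d -> R)
    (hac : mu `<< @sphere_volume R d)
    (hf : is_density mu f)
    (p : sphere R d) (j : nat) (hj : (1 <= j <= 4)%N)
    (hcut : exists eps : R, 0 < eps /\
      ((j <= d)%N -> exists M : R,
         forall y, geodesic_ball (antipode p) eps y -> `|f y| <= M) /\
      ((d < j)%N ->
         forall y, geodesic_ball (antipode p) eps y -> f y = 0)) :
  exists U : set (sphere R d),
    [/\ open U, U p & sphere_differentiable_order j U (frechet_function mu)].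
Proof.
have j0 : (0 < j)%N by case/andP: hj.
have [dl dl0 [C C0 HC]] := mass_cap_bound hd j0 hf hcut.
(* The mass bound is stated on the sphere, without charts, so this one set serves for both
   stereographic charts. *)
exists [set x | normsq (set_val x - set_val p) < dl]; split.
- exact: open_sphere_nbhd.
- rewrite /= subrr (_ : normsq 0 = 0)//.
  by rewrite /normsq /dot big1// => i _; rewrite mxE mul0r.
- by move=> s; exact: frechet_differentiable_order_chart HC.
Qed.
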